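(* Let $1/2<s<1$, $C>0$, $R>0$. Let $W$ be a random variable in $\mathbb{R}^2$ which is $(2s,C)$-Frostman with range contained in the ball $B(0,R)$, and let $W'$ be an independent copy of $W$. Then for every $t$ with $t\le 1$ and $s<t<2s-1/2$ there are an absolute constant $K$ and a constant $K_t$ depending only on $t$ such that for all $n\in\mathbb{N}$, $$H_n(|W-W'|)\ge nt-\log_+C-K\log_+R-K|\log(2s-t-1/2)|-K_t.$$
   Context: Logarithms base 2, $\log_+x=\max\{\log x,0\}$. $D_n(x)=\lfloor 2^nx\rfloor/2^n$; $H_n(Z):=H(D_n(Z))$, the Shannon entropy. A random variable $W$ in $\mathbb{R}^2$ is $(\sigma,C)$-Frostman if $P(W\in B(x,r))\le Cr^\sigma$ for all $x\in\mathbb{R}^2$, $r>0$. *)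

(* Defs.v *)
From HB Require Import structures.
From mathcomp Require Import all_boot all_order all_algebra.
From mathcomp Require Import all_classical all_reals all_analysis.
Set Implicit Arguments. Unset Strict Implicit. Unset Printing Implicit Defensive.
Import Order.TTheory GRing.Theory Num.Theory.
Local Open Scope classical_set_scope.
Local Open Scope ring_scope.

Definition log2 {R : realType} (x : R) : R := ln x / ln 2.
Definition logp {R : realType} (x : R) : R := Num.max (log2 x) 0.

Definition dist2 {R : realType} (x y : R * R) : R :=
  Num.sqrt ((x.1 - y.1) ^+ 2 + (x.2 - y.2) ^+ 2).

Definition ball2 {R : realType} (x : R * R) (r : R) : set (R * R) :=
  [set y | dist2 x y < r].

Definition Dn {R : realType} (n : nat) (x : R) : R :=
  (Num.floor (2 ^+ n * x))%:~R / 2 ^+ n.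

(* Shannon entropy (base 2) of a discrete real random variable X:
   H(X) = sum over values v of X of -P(X=v) log2 P(X=v), with 0 log 0 = 0,
   as an extended real (a sum of nonnegative terms). *)
Definition entropy {R : realType} {d} {T : measurableType d}
  (P : probability T R) (X : T -> R) : \bar R :=
  (\esum_(v in range X)
     (let p := fine (P (X @^-1` [set v])) in
      if p == 0 then 0 else - (p * log2 p))%:E)%E.

Definition Hn {R : realType} {d} {T : measurableType d}
  (P : probability T R) (n : nat) (Z : T -> R) : \bar R :=
  entropy P (Dn n \o Z).

Definition frostman {R : realType} {d} {T : measurableType d}
  (P : probability T R) (W : T -> R * R) (sigma C : R) : Prop :=
  forall (x : R * R) (r : R), 0 < r ->
    (P (W @^-1` ball2 x r) <= (C * r `^ sigma)%:E)%E.

Definition independent_copy {R : realType} {d} {T : measurableType d}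
  (P : probability T R) (W W' : T -> R * R) : Prop :=
  (forall A : set (R * R), measurable A ->
     P (W' @^-1` A) = P (W @^-1` A)) /\
  (forall A B : set (R * R), measurable A -> measurable B ->
     P (W @^-1` A `&` W' @^-1` B) = (P (W @^-1` A) * P (W' @^-1` B))%E).

(* Main.v *)
(* Let D = |W - W'|. It suffices to bound P(a <= D < a + 2^-n) by 2^(-nt) times the
   admissible constants, uniformly in a: entropy is at least -log of the largest mass.
   This is Falconer's argument, carried out with finite trigonometric sums after
   discretising W/Rad on a dyadic mesh.

   The Fejer kernel F_M(x) = |sum_(k < M) e^(ikx)|^2 is nonnegative, has nonnegative
   Fourier coefficients, and is of size M^2 near 0. Hence the average of
   F_M(x_1 - r cos phi) F_M(x_2 - r sin phi) over phi, with M ~ 1/delta, majorises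
   (up to scaling) the indicator of the annulus | |x| - r | < delta. Its Fourier
   coefficients are those of the planar Fejer kernel times J_0(r |xi|), and
   |J_0(y)| <~ y^(-1/2). Since E cos(xi . (W - W')) = |E e^(i xi . W)|^2 >= 0, the kernel
   may be replaced, frequency by frequency, by the sum over dyadic scales 2^J <= M of
   2^(-J/2) times Fejer kernels of order 2^(J+1); the expectations of the latter are
   controlled directly by the Frostman condition at scale 2^-J. *)
Require Import Defs.
From HB Require Import structures.
From mathcomp Require Import all_boot all_order all_algebra.
From mathcomp Require Import all_classical all_reals all_analysis.
From mathcomp Require Import measurable_realfun.
From mathcomp Require Import ring lra.
Import Order.TTheory GRing.Theory Num.Theory.
Import numFieldNormedType.Exports.
Local Open Scope classical_set_scope.
Local Open Scope ring_scope.

Set Implicit Arguments.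
Unset Strict Implicit.
Unset Printing Implicit Defensive.

(** * Continuity of pointwise combinations of real functions *)

Section Continuity.
Context {R : realType}.

Lemma continuous_cstf (c : R) : continuous (fun _ : R => c).
Proof. by move=> x; exact: cst_continuous. Qed.

Lemma continuous_mulf (f g : R -> R) :
  continuous f -> continuous g -> continuous (fun x => f x * g x).
Proof. by move=> cf cg x; apply: continuousM; [exact: cf|exact: cg]. Qed.

Lemma continuous_addf (f g : R -> R) :
  continuous f -> continuous g -> continuous (fun x => f x + g x).
Proof. by move=> cf cg x; apply: continuousD; [exact: cf|exact: cg]. Qed.

Lemma continuous_subf (f g : R -> R) :
  continuous f -> continuous g -> continuous (fun x => f x - g x).
Proof. by move=> cf cg x; apply: continuousB; [exact: cf|exact: cg]. Qed.

Lemma continuous_compf (f g : R -> R) :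
  continuous f -> continuous g -> continuous (fun x => g (f x)).
Proof. by move=> cf cg x; apply: continuous_comp; [exact: cf|exact: cg]. Qed.

Lemma continuous_sum (J : Type) (s : seq J) (f : J -> R -> R) :
  (forall i, continuous (f i)) -> continuous (fun x => \sum_(i <- s) f i x).
Proof.
move=> cf x; elim: s => [|i s IH].
  by under eq_fun do rewrite big_nil; exact: cst_continuous.
by under eq_fun do rewrite big_cons; apply: continuousD => //; exact: cf.
Qed.

End Continuity.

(** * Elementary bounds for sine and cosine *)

Section Trig.
Context {R : realType}.
Implicit Types x y : R.

Lemma sin_le x : 0 <= x -> sin x <= x.
Proof.
move=> x0; have [|c _] := @MVT_segment R (@sin R) (@cos R) 0 x x0.
  by apply: continuous_subspaceT => y; exact: continuous_sin.
rewrite sin0 !subr0 => ->.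
by rewrite -[leRHS]mul1r ler_wpM2r// cos_le1.
Qed.

(** Since cos x = 1 - 2 sin^2(x/2), it suffices that |sin(x/2)| <= x/2 for nonnegative x. *)
Lemma cos_ge x : 1 - x ^+ 2 / 2 <= cos x.
Proof.
wlog x0 : x / 0 <= x => [H|].
  have [/H//|/ltW x0] := leP 0 x.
  by rewrite -cosN -sqrrN; apply: H; rewrite oppr_ge0.
have e : cos x = 1 - 2 * sin (x / 2) ^+ 2.
  have {1}-> : x = (x / 2) *+ 2 by rewrite -mulr_natr; field.
  by rewrite cos_mulr2n cos2sin2 -mulr_natr; ring.
have s1 : sin (x / 2) <= x / 2 by apply: sin_le; lra.
have s2 : - (x / 2) <= sin (x / 2).
  have [h|h] := leP (x / 2) 2; last by have := sin_geN1 (x/2); lra.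
  have : 0 <= sin (x / 2); last by lra.
  have [->|hx] := eqVneq x 0; first by rewrite mul0r sin0.
  have [hh|hh] := ltP (x/2) 2.
    by apply/ltW/sin2_gt0; rewrite hh andbT divr_gt0// lt_neqAle eq_sym hx.
  by apply: sin_ge0_pi; have := @pi_ge2 R; lra.
rewrite e; nra.
Qed.

(** On [0, 1] the derivative of sine is at least 1 - c^2/2 >= 1/2. *)
Lemma sin_ge x : 0 <= x <= 1 -> x / 2 <= sin x.
Proof.
move=> /andP[x0 x1]; have [|c cx] := @MVT_segment R (@sin R) (@cos R) 0 x x0.
  by apply: continuous_subspaceT => y; exact: continuous_sin.
rewrite sin0 !subr0 => ->; rewrite mulrC ler_wpM2r//.
move: cx; rewrite in_itv/= => /andP[c0 cx].
apply: le_trans (cos_ge c).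
have : c ^+ 2 <= 1 by rewrite expr_le1//; lra.
by lra.
Qed.

End Trig.

(** * Fejer kernels *)

Section Fejer.
Context {R : realType}.
Implicit Types x y : R.

(* [M - a] is truncated, so the coefficient vanishes for [a >= M]. *)
Definition fejw (M a : nat) : R := (if a == 0%N then 1 else 2) * (M - a)%:R.

(** The frequencies a and -a of |sum_(k < M) e^(ikx)|^2 are merged into one cosine, hence the factor
    2 in [fejw]; [M - a] counts the pairs k, l < M with k - l = a. *)
Definition fejer (M : nat) x : R := \sum_(a < M) fejw M a * cos (a%:R * x).

Lemma fejw_ge0 M a : 0 <= fejw M a.
Proof. by rewrite /fejw; case: ifP => _; rewrite mulr_ge0. Qed.

Lemma fejw_le M a : fejw M a <= 2 * M%:R.
Proof.
rewrite /fejw ler_pM//; first by case: ifP.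
- by case: ifP => _ //; rewrite ler1n.
- by rewrite ler_nat leq_subr.
Qed.

(** Lets kernels of different orders be expanded over one range of frequencies and compared
    coefficient by coefficient. *)
Lemma fejer_wide M L x : (M <= L)%N ->
  fejer M x = \sum_(a < L) fejw M a * cos (a%:R * x).
Proof.
move=> ML; rewrite /fejer (big_ord_widen L (fun a => fejw M a * cos (a%:R * x)) ML).
rewrite big_mkcond; apply: eq_bigr => a _; case: ltnP => // Ma.
by rewrite /fejw (eqP (_ : M - a == 0)%N) ?subn_eq0// mulr0 mul0r.
Qed.

Let C M x : R := \sum_(k < M) cos (k%:R * x).
Let S M x : R := \sum_(k < M) sin (k%:R * x).

(** [C] and [S] are the real and imaginary parts of the geometric sum of the e^(ikx). By induction
    on M: adding e^(iMx) to that sum increases its squared modulus by 1 + 2 sum_(k < M) cos((M - k)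
    x), which is the increment of the kernel. *)
Lemma fejerE M x : fejer M x = C M x ^+ 2 + S M x ^+ 2.
Proof.
elim: M => [|M IH]; first by rewrite /fejer /C /S !big_ord0; ring.
have -> : fejer M.+1 x = fejer M x + \sum_(a < M.+1) (if a == 0%N :> nat then 1 else 2) * cos (a%:R * x).
  rewrite (@fejer_wide M M.+1)// -big_split/=; apply: eq_bigr => a _.
  have aM : (a <= M)%N by rewrite -ltnS.
  by rewrite /fejw subSn// -[(M - a).+1%:R]natr1; case: ifP => _; ring.
rewrite IH /C /S !big_ord_recr/=.
have -> : \sum_(a < M) (if a == 0%N :> nat then 1 else 2) * cos (a%:R * x) + (if M == 0%N then 1 else 2) * cos (M%:R * x)
  = 1 + 2 * \sum_(k < M) cos (M%:R * x - k%:R * x).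
  rewrite -(@big_ord_recr _ _ _ M (fun a : 'I_M.+1 => (if a == 0%N :> nat then 1 else 2) * cos (a%:R * x))) big_ord_recl/= mul0r cos0 mulr1.
  congr (_ + _); rewrite mulr_sumr [RHS](reindex_inj rev_ord_inj)/=.
  apply: eq_bigr => a _; congr (_ * cos _).
  by rewrite /bump add1n -mulrBl -natrB ?subKn ?leq_subr ?ltn_ord//.
have -> : \sum_(k < M) cos (M%:R * x - k%:R * x) = cos (M%:R * x) * C M x + sin (M%:R * x) * S M x.
  by rewrite /C /S !mulr_sumr -big_split/=; apply: eq_bigr => k _; rewrite cosB.
rewrite -/(C M x) -/(S M x).
have := cos2Dsin2 (M%:R * x).
set c := cos (M%:R * x); set s := sin (M%:R * x) => h.
lra.
Qed.

Lemma fejer_ge0 M x : 0 <= fejer M x.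
Proof. by rewrite fejerE addr_ge0 ?sqr_ge0. Qed.

Lemma fejer_le M x : fejer M x <= M%:R ^+ 2.
Proof.
(* The total weight, read off from [fejerE] at x = 0. *)
have -> : M%:R ^+ 2 = \sum_(a < M) fejw M a :> R.
  have := fejerE M 0; rewrite /fejer /C /S.
  under eq_bigr do rewrite mulr0 cos0 mulr1.
  move=> ->; under eq_bigr do rewrite mulr0 cos0.
  under [X in _ + X ^+ 2]eq_bigr do rewrite mulr0 sin0.
  by rewrite sumr_const card_ord big1// expr0n addr0.
apply: ler_sum => a _.
by rewrite -[leRHS]mulr1 ler_wpM2l ?fejw_ge0 ?cos_le1.
Qed.

(** All angles [k * x] lie in [-1, 1], so every cosine in [C] is at least 1/2 and [C] alone
    contributes (M/2)^2. *)
Lemma fejer_near M x : `|M%:R * x| <= 1 -> M%:R ^+ 2 / 4 <= fejer M x.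
Proof.
move=> Mx; have h : M%:R / 2 <= C M x.
  have -> : M%:R / 2 = \sum_(k < M) (1 / 2) :> R by rewrite sumr_const card_ord -mulr_natr; field.
  apply: ler_sum => k _; apply: le_trans (cos_ge _).
  have : (k%:R * x) ^+ 2 <= 1; last by lra.
  rewrite -real_normK ?num_real// expr_le1//; apply: le_trans Mx.
  by rewrite !normrM ler_wpM2r// !ger0_norm// ler_nat ltnW.
rewrite fejerE; have M0 : 0 <= M%:R :> R by [].
have := sqr_ge0 (S M x); nra.
Qed.

(** Telescoping: 1 - e^(ix) times the geometric sum is 1 - e^(iMx). [e1] records the real and
    imaginary parts of this identity; comparing squared moduli gives the claim. *)
Lemma fejer_mul M x : fejer M x * (1 - cos x) = 1 - cos (M%:R * x).
Proof.
rewrite fejerE; set c := cos x; set s := sin x.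
have cs : c ^+ 2 + s ^+ 2 = 1 by exact: cos2Dsin2.
have e1 : C M x - c * C M x + s * S M x = 1 - cos (M%:R * x) /\
          S M x - c * S M x - s * C M x = - sin (M%:R * x).
  rewrite /C /S; elim: M => [|M [IH1 IH2]].
    by rewrite !big_ord0 mul0r cos0 sin0; split; ring.
  rewrite !big_ord_recr/= -natr1 mulrDl mul1r cosD sinD -/c -/s.
  by split; lra.
have cs' := cos2Dsin2 (M%:R * x).
have : (C M x - c * C M x + s * S M x) ^+ 2 + (S M x - c * S M x - s * C M x) ^+ 2
   = 2 * ((C M x ^+ 2 + S M x ^+ 2) * (1 - c)).
  have -> : 2 * ((C M x ^+ 2 + S M x ^+ 2) * (1 - c)) =
    (C M x ^+ 2 + S M x ^+ 2) * (1 - 2 * c + (c ^+ 2 + s ^+ 2)) by rewrite cs; ring.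
  ring.
by rewrite e1.1 e1.2; nra.
Qed.

(** In [fejer_mul] the right-hand side is at most 2, while 1 - cos x = 2 sin^2(|x|/2) >= x^2/8
    because |x|/2 <= 1. *)
Lemma fejer_far M x : x != 0 -> `|x| <= 2 -> fejer M x * x ^+ 2 <= 16.
Proof.
move=> x0 x2; set y := `|x| / 2.
have xy : x ^+ 2 = 4 * y ^+ 2.
  by rewrite -[in LHS]real_normK ?num_real// /y; field.
have y01 : 0 <= y <= 1 by rewrite /y; have := normr_ge0 x; lra.
have sy := sin_ge y01.
have e : 1 - cos x = 2 * sin y ^+ 2.
  have -> : cos x = cos (y *+ 2).
    by rewrite -cos_norm; congr cos; rewrite /y -mulr_natr; field.
  by rewrite cos_mulr2n cos2sin2 -mulr_natr; ring.
have := fejer_mul M x; rewrite e => h.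
have := cos_geN1 (M%:R * x); have F0 := fejer_ge0 M x.
have y2 : y ^+ 2 <= 4 * sin y ^+ 2 by nra.
nra.
Qed.

End Fejer.

(** * Positive definiteness *)

Section PositiveDefinite.
Context {R : realType} {I : finType}.
Variable m : I -> R.
Implicit Types (p q al : I -> R) (u v be : R).

(** This is |sum_i m_i e^(i al_i)|^2; for phases linear in the position it is a squared Fourier
    coefficient of the weights [m]. *)
Definition energy al : R :=
  (\sum_i m i * cos (al i)) ^+ 2 + (\sum_i m i * sin (al i)) ^+ 2.

Lemma energy_ge0 al : 0 <= energy al.
Proof. by rewrite addr_ge0 ?sqr_ge0. Qed.

(** The double sum of m_i m_j e^(i(al_i - al_j)) is the energy, hence real: its imaginary part is
    antisymmetric in i and j. A shift by [be] therefore acts only through its cosine. *)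
Lemma sum_cos_energy al be :
  \sum_i \sum_j m i * m j * cos (al i - al j - be) = cos be * energy al.
Proof.
have E (f g : I -> R) : (\sum_i m i * f i) * (\sum_j m j * g j) = \sum_i \sum_j m i * m j * (f i * g j).
  by rewrite big_distrlr/=; apply: eq_bigr => i _; apply: eq_bigr => j _; ring.
pose c i := cos (al i); pose s i := sin (al i).
have <- : cos be * (\sum_i \sum_j m i * m j * (c i * c j) + \sum_i \sum_j m i * m j * (s i * s j))
  + sin be * (\sum_i \sum_j m i * m j * (s i * c j) - \sum_i \sum_j m i * m j * (c i * s j)) =
  cos be * energy al.
  by rewrite -!E /energy -/c -/s; ring.
rewrite -big_split -sumrB !mulr_sumr -big_split; apply: eq_bigr => i _ /=.
rewrite -big_split -sumrB !mulr_sumr -big_split; apply: eq_bigr => j _ /=.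
by rewrite cosB cosB sinB /c /s; ring.
Qed.

(** The product-to-sum formula turns each pair a, b into the frequencies (a, b) and (a, -b). The
    weights and energies are nonnegative, and the shift (u, v) survives only in the cosines, where
    it can be averaged over a circle. *)
Lemma sum_fejer M L p q u v : (M <= L)%N ->
  \sum_i \sum_j m i * m j * (fejer M (p i - p j - u) * fejer M (q i - q j - v)) =
  \sum_(a < L) \sum_(b < L) fejw M a * fejw M b / 2 *
   (energy (fun i => a%:R * p i + b%:R * q i) * cos (a%:R * u + b%:R * v)
  + energy (fun i => a%:R * p i - b%:R * q i) * cos (a%:R * u - b%:R * v)).
Proof.
move=> ML.
transitivity (\sum_i \sum_j \sum_(a < L) \sum_(b < L) fejw M a * fejw M b / 2 *
  (m i * m j * cos ((a%:R * p i + b%:R * q i) - (a%:R * p j + b%:R * q j) - (a%:R * u + b%:R * v)) +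
   m i * m j * cos ((a%:R * p i - b%:R * q i) - (a%:R * p j - b%:R * q j) - (a%:R * u - b%:R * v)))).
  apply: eq_bigr => i _; apply: eq_bigr => j _.
  rewrite !(fejer_wide _ ML) big_distrlr/= mulr_sumr; apply: eq_bigr => a _.
  rewrite mulr_sumr; apply: eq_bigr => b _.
  set x := a%:R * (p i - p j - u); set y := b%:R * (q i - q j - v).
  rewrite (_ : _ - _ - _ = x + y); last by rewrite /x /y; ring.
  rewrite (_ : _ - _ - (_ - _) = x - y); last by rewrite /x /y; ring.
  by rewrite cosD cosB; field.
under eq_bigr do rewrite exchange_big/=.
rewrite exchange_big/=; apply: eq_bigr => a _.
under eq_bigr do rewrite exchange_big/=.
rewrite exchange_big/=; apply: eq_bigr => b _.
under eq_bigr do rewrite -mulr_sumr big_split/=.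
by rewrite -mulr_sumr big_split/= !sum_cos_energy; ring.
Qed.

End PositiveDefinite.

(** * Integration over the circle *)

Section CircleAverage.
Context {R : realType}.
Let mu := @lebesgue_measure R.
Implicit Types f g : R -> R.

(** Not normalised: the constant 1 integrates to 2 pi. *)
Definition circint f : R := \int[mu]_(x in `[- pi, pi]%classic) f x.

Lemma mu_itv (h : R) : 0 <= h -> forall a, mu `[a, a + h]%classic = h%:E.
Proof.
move=> h0 a; rewrite /mu lebesgue_measure_itv/= lte_fin.
have [h'|h'] := ltP a (a + h); last by congr EFin; lra.
by rewrite -EFinB; congr EFin; ring.
Qed.

Lemma continuous_integrable_itv (a b : R) f : continuous f ->
  mu.-integrable `[a, b]%classic (EFin \o f).
Proof.
move=> cf; apply: continuous_compact_integrable; first exact: segment_compact.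
exact: continuous_subspaceT.
Qed.

Lemma circint_sum (J : Type) (s : seq J) (f : J -> R -> R) :
  (forall i, continuous (f i)) ->
  circint (fun x => \sum_(i <- s) f i x) = \sum_(i <- s) circint (f i).
Proof.
move=> cf; rewrite /circint; elim: s => [|i s IH].
  by under eq_Rintegral do rewrite big_nil; rewrite Rintegral_cst// mul0r big_nil.
under eq_Rintegral do rewrite big_cons.
rewrite RintegralD ?IH ?big_cons//; apply: continuous_integrable_itv => //.
exact: continuous_sum.
Qed.

Lemma circintD (f g : R -> R) : continuous f -> continuous g ->
  circint (fun x => f x + g x) = circint f + circint g.
Proof.
by move=> cf cg; apply: RintegralD => //; exact: continuous_integrable_itv.
Qed.

Lemma circintZ (c : R) f : continuous f -> circint (fun x => c * f x) = c * circint f.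
Proof. by move=> cf; apply: RintegralZl => //; exact: continuous_integrable_itv. Qed.

Lemma le_circint f g : continuous f -> continuous g -> (forall x, f x <= g x) ->
  circint f <= circint g.
Proof.
by move=> cf cg fg; apply: le_Rintegral => //; exact: continuous_integrable_itv.
Qed.

Lemma circint_arc f (c a h : R) : continuous f -> (forall x, 0 <= f x) -> 0 <= h ->
  - pi <= a -> a + h <= pi -> (forall x, a <= x <= a + h -> c <= f x) ->
  c * h <= circint f.
Proof.
move=> cf f0 h0 a1 a2 fc.
have sub : `[a, a + h]%classic `<=` (`[- pi, pi]%classic : set R).
  by move=> x /=; rewrite !in_itv/=; lra.
have mJ : measurable (`[a, a + h]%classic : set R) by exact: measurable_itv.
apply: (@le_trans _ _ (\int[mu]_(x in `[a, a + h]%classic) f x)).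
  have <- : \int[mu]_(x in `[a, a + h]%classic) c = c * h.
    by rewrite Rintegral_cst//; congr (_ * _); rewrite -[RHS]/(fine h%:E); congr fine; exact: mu_itv.
  apply: le_Rintegral => //.
  - by apply: continuous_integrable_itv; exact: cst_continuous.
  - exact: continuous_integrable_itv.
apply: fine_le.
- by apply: integrable_fin_num => //; exact: continuous_integrable_itv.
- by apply: integrable_fin_num => //; exact: continuous_integrable_itv.
apply: ge0_subset_integral => //.
- have : mu.-integrable `[- pi, pi]%classic (EFin \o f) by exact: continuous_integrable_itv.
  by case/integrableP.
- by move=> x _; rewrite lee_fin.
Qed.

Lemma circint_cst (c : R) : circint (fun=> c) = c * (2 * pi).
Proof.
have pp : 0 <= 2 * pi :> R by have := @pi_gt0 R; lra.
rewrite /circint Rintegral_cst//; congr (_ * _); rewrite -[RHS]/(fine (2 * pi)%:E); congr fine.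
have {2}-> : (pi : R) = - pi + 2 * pi by ring.
exact: mu_itv.
Qed.

Lemma circint_derive f (F : R -> R) : continuous f ->
  (forall x : R, is_derive x 1 F (f x)) -> circint f = F pi - F (- pi).
Proof.
move=> cf dF; rewrite /circint /Rintegral.
rewrite (@continuous_FTC2 _ f F)//.
- have := @pi_gt0 R; lra.
- exact: continuous_subspaceT.
- have cF x : {for x, continuous F}.
    by apply/differentiable_continuous/derivable1_diffP/ex_derive; exact: dF.
  split; last 2 first.
  - exact/cvg_at_right_filter/cF.
  - exact/cvg_at_left_filter/cF.
  by move=> x _; apply: ex_derive; exact: dF.
- by move=> x _; rewrite derive1E; apply: derive_val.
Qed.

End CircleAverage.

(** * Decay of the Bessel function J_0 *)

Section Bessel.
Context {R : realType}.

Lemma pi_lt4 : pi < 4 :> R.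
Proof. by have := @pihalf_lt2 R; lra. Qed.

Variables (A B rho : R).
Hypothesis rho1 : 1 <= rho.
Hypothesis rhoE : rho ^+ 2 = A ^+ 2 + B ^+ 2.

(** [f] is a sinusoid of amplitude [rho] and [g] is its derivative. [D] compares [g ^+ 2] with
    [rho], its size at distance about rho^(-1/2) from a stationary point, which is the scale of
    stationary phase. *)
Let f x : R := A * cos x + B * sin x.
Let g x : R := B * cos x - A * sin x.
Let D x : R := rho + g x ^+ 2.
Let s : R := Num.sqrt rho.
Let c : R := 2 / (s * (rho + 1)).

(* Both [psi] and [theta] are 2 pi-periodic, and [cos f <= 6 / s + psi' - c * theta'];
   integrating over a period kills the derivatives. [psi] integrates [cos f] by parts with
   the weight [g^2 / (rho + g^2)], which avoids the stationary points [g = 0]; the error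
   [2 rho / (rho + g^2)] is then absorbed by [theta] because [f^2 + g^2 = rho^2]. *)
Let psi x : R := sin (f x) * g x * (D x)^-1.
Let theta x : R := f x * atan (g x / s).
Let dpsi x : R := (cos (f x) * g x ^+ 2 - sin (f x) * f x) / D x
  + 2 * sin (f x) * f x * g x ^+ 2 / D x ^+ 2.
Let dtheta x : R := g x * atan (g x / s) - f x ^+ 2 * s / D x.

Let rho0 : 0 < rho. Proof. by apply: lt_le_trans rho1. Qed.
Let s0 : 0 < s. Proof. by rewrite sqrtr_gt0. Qed.
Let s2 : s ^+ 2 = rho. Proof. by rewrite sqr_sqrtr// ltW. Qed.
Let D0 x : 0 < D x. Proof. by rewrite ltr_pwDl// sqr_ge0. Qed.

Let fg x : f x ^+ 2 + g x ^+ 2 = rho ^+ 2.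
Proof.
have -> : f x ^+ 2 + g x ^+ 2 = (A ^+ 2 + B ^+ 2) * (cos x ^+ 2 + sin x ^+ 2).
  by rewrite /f /g; ring.
by rewrite cos2Dsin2 mulr1.
Qed.

Let absle (u : R) : u ^+ 2 <= rho ^+ 2 -> `|u| <= rho.
Proof. by move=> h; rewrite -(ger0_norm (ltW rho0)) -ler_sqr ?nnegrE// !real_normK ?num_real. Qed.

Let pointwise x : cos (f x) <= 6 / s + (dpsi x - c * dtheta x).
Proof.
(* After subtracting [dpsi], what remains of cos f carries a factor 1 / D; [e4] bounds its numerator
   by 2 rho, using |f| <= rho and |rho - g^2| <= D. *)
have e1 : cos (f x) - dpsi x =
    (rho * cos (f x) + sin (f x) * f x * ((rho - g x ^+ 2) / D x)) / D x.
  by rewrite /dpsi /D; field; rewrite gt_eqF//; exact: D0.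
(* [c] is normalised for this identity: since f^2 = rho^2 - g^2, adding [s] to s f^2 / D gives s rho
   (rho + 1) / D. *)
have e2 : 2 * rho / D x = c * (s + g x * atan (g x / s) - dtheta x).
  have -> : s + g x * atan (g x / s) - dtheta x = s * (rho * (rho + 1)) / D x.
    have -> : dtheta x = g x * atan (g x / s) - (rho ^+ 2 - g x ^+ 2) * s / D x.
      by rewrite -(fg x) /dtheta; field; rewrite gt_eqF.
    by rewrite /D; field; rewrite gt_eqF//; exact: D0.
  by rewrite /c; field; rewrite !gt_eqF// addr_gt0.
(* Here |g| <= rho, |atan| < pi/2 < 2 and s <= rho, so the bracket is at most 3 rho. *)
have e3 : c * (s + g x * atan (g x / s)) <= 6 / s.
  have hg : g x * atan (g x / s) <= 2 * rho.
    have := atan_gtNpi2 (g x / s); have := atan_ltpi2 (g x / s).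
    have := @pihalf_lt2 R; set a := atan _ => h1 h2 h3.
    apply: le_trans (ler_norm _) _; rewrite normrM mulrC ler_pM//.
      by rewrite ler_norml; lra.
    by apply: absle; rewrite -(fg x) lerDr sqr_ge0.
  have s1 : 1 <= s by rewrite /s -[leLHS]sqrtr1 ler_wsqrtr.
  have hs : s <= rho by rewrite -s2 expr2 ler_peMr// ltW.
  rewrite /c mulrAC ler_pdivrMr ?mulr_gt0 ?addr_gt0//.
  rewrite (_ : 6 / s * (s * (rho + 1)) = 6 * (rho + 1)); last by field; rewrite gt_eqF.
  lra.
have e4 : cos (f x) - dpsi x <= 2 * rho / D x.
  rewrite e1 ler_pM2r ?invr_gt0//.
  have h1 := cos_le1 (f x).
  have h2 : sin (f x) * f x * ((rho - g x ^+ 2) / D x) <= rho.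
    apply: le_trans (ler_norm _) _; rewrite !normrM -[leRHS]mul1r -[leRHS]mulr1.
    rewrite ler_pM ?mulr_ge0//; last first.
      rewrite -normrM normrM normfV ler_pdivrMr ?normr_gt0 ?gt_eqF// mul1r.
      by rewrite [leRHS]gtr0_norm// ler_norml /D; have := sqr_ge0 (g x); have := rho0; lra.
    rewrite ler_pM ?sin_max//.
    by apply: absle; rewrite -(fg x) lerDl sqr_ge0.
  have h3 : rho * cos (f x) <= rho by rewrite ger_pMr.
  lra.
lra.
Qed.

Let dF (x : R) : is_derive x 1 f (g x).
Proof. by rewrite /f /g; apply: is_derive_eq; rewrite /GRing.scale/=; ring. Qed.

Let dG (x : R) : is_derive x 1 g (- f x).
Proof. by rewrite /f /g; apply: is_derive_eq; rewrite /GRing.scale/=; ring. Qed.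

Let dPsi (x : R) : is_derive x 1 psi (dpsi x).
Proof.
have dS : is_derive x 1 (fun y => sin (f y)) (cos (f x) * g x) by apply: is_derive1_comp.
have dD : is_derive x 1 D (2 * g x * (- f x)).
  by rewrite /D; apply: is_derive_eq; rewrite /GRing.scale/= /f; ring.
have dV := is_deriveV (lt0r_neq0 (D0 x)) dD.
rewrite /psi; apply: is_derive_eq; rewrite /GRing.scale/= /dpsi.
have -> : B * - sin x - A * cos x = - f x by rewrite /f; ring.
field.
by rewrite gt_eqF.
Qed.

Let dTheta (x : R) : is_derive x 1 theta (dtheta x).
Proof.
have dS : is_derive x 1 (fun y => g y / s) (- f x / s).
  by apply: is_derive_eq; rewrite /GRing.scale/= /f; ring.
have dA : is_derive x 1 (fun y => atan (g y / s)) ((1 + (g x / s) ^+ 2)^-1 * (- f x / s)).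
  exact: is_derive1_comp.
rewrite /theta; apply: is_derive_eq; rewrite /GRing.scale/= /dtheta.
have -> : (1 + (g x / s) ^+ 2)^-1 = rho / D x.
  rewrite /D -s2; field; rewrite !gt_eqF//.
  by rewrite ltr_pwDl ?sqr_ge0// exprn_gt0.
have -> : A * - sin x + B * cos x = g x by rewrite /g; ring.
by rewrite -s2; field; rewrite !gt_eqF.
Qed.

Let cts (h dh : R -> R) : (forall x : R, is_derive x 1 h (dh x)) -> continuous h.
Proof.
by move=> d x; apply/differentiable_continuous/derivable1_diffP/ex_derive; exact: d.
Qed.

Lemma circint_cos_le1 : circint (fun x => cos (A * cos x + B * sin x)) <= 50 / s.
Proof.
have cf := cts dF; have cg := cts dG.
have ccst (k : R) : continuous (fun _ : R => k) by exact: continuous_cstf.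
have csf := continuous_compf cf (@continuous_sin R).
have ccf := continuous_compf cf (@continuous_cos R).
have cat : continuous (fun x => atan (g x / s)).
  move=> x; apply: (@continuous_comp _ _ _ (fun x => g x / s)); last exact: continuous_atan.
  exact: continuous_mulf.
have cD : continuous (fun x => (D x)^-1).
  by move=> x; apply: continuousV; [rewrite gt_eqF|apply: continuous_addf => //; apply: continuous_mulf].
have cD2 : continuous (fun x => (D x ^+ 2)^-1).
  by under eq_fun do rewrite -exprVn; exact: continuous_mulf.
have cdpsi : continuous dpsi.
  apply: continuous_addf; apply: continuous_mulf => //; first by apply: continuous_subf; [apply: continuous_mulf => //; exact: continuous_mulf|exact: continuous_mulf].
  by apply: continuous_mulf; [apply: continuous_mulf => //; exact: continuous_mulf|exact: continuous_mulf].
have cdtheta : continuous dtheta.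
  apply: continuous_subf; first exact: continuous_mulf.
  by apply: continuous_mulf => //; apply: continuous_mulf => //; exact: continuous_mulf.
have cQ : continuous (fun x => 6 / s + (dpsi x - c * dtheta x)).
  by apply: continuous_addf => //; apply: continuous_subf => //; exact: continuous_mulf.
apply: le_trans (le_circint ccf cQ pointwise) _.
pose F (x : R) : R := (6 / s) * x + (psi x - c * theta x).
have -> : circint (fun x => 6 / s + (dpsi x - c * dtheta x)) = F pi - F (- pi).
  apply: circint_derive; first exact: cQ.
  move=> x.
  have d1 : is_derive x 1 (fun y : R => 6 / s * y) (6 / s).
    by apply: is_derive_eq; rewrite /GRing.scale/=; ring.
  exact: (is_deriveD d1 (is_deriveB (dPsi x) (is_deriveZ c (dTheta x)))).
rewrite /F.
(* By periodicity the boundary values of [psi] and [theta] cancel; what is left is 12 pi / s, below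
   48 / s. *)
have gpi : g (- pi) = g pi by rewrite /g cosN sinN sinpi oppr0.
have fpi : f (- pi) = f pi by rewrite /f cosN sinN sinpi oppr0.
rewrite /psi /theta /D gpi fpi.
have := pi_lt4; have := @pi_gt0 R => p0 p4.
have i0 : 0 < s^-1 by rewrite invr_gt0.
by nra.
Qed.

End Bessel.

Lemma circint_cos_le {R : realType} (A B rho : R) : 0 < rho ->
  rho ^+ 2 = A ^+ 2 + B ^+ 2 ->
  circint (fun x => cos (A * cos x + B * sin x)) <= 50 / Num.sqrt rho.
Proof.
move=> rho0 rhoE; have [r1|r1] := leP 1 rho; first exact: circint_cos_le1.
have cf : continuous (fun x => cos (A * cos x + B * sin x)).
  move=> x; apply: (@continuous_comp _ _ _ (fun x => A * cos x + B * sin x)); last exact: continuous_cos.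
  apply: continuousD; (apply: continuousM; first exact: cst_continuous).
    exact: continuous_cos.
  exact: continuous_sin.
apply: le_trans (le_circint (g := cst 1) cf _ _) _ => //.
- by move=> x; exact: cst_continuous.
- by move=> x; exact: cos_le1.
rewrite circint_cst mul1r; have := @pi_lt4 R => p4.
apply: (@le_trans _ _ 50); first by lra.
rewrite ler_pdivlMr ?sqrtr_gt0// ger_pMr//.
by rewrite -[leRHS]sqrtr1 ler_wsqrtr// ltW.
Qed.

(** * The annulus estimate for finite weights *)

Section Cells.
Context {R : realType}.

(** Decay profile of a Fejer kernel at about a mesh widths from 0; [maxn] caps it at 1 in the
    central cell. *)
Definition kappa (a : nat) : R := ((maxn 1 a)%:R ^+ 2)^-1.

Lemma kappa_ge0 a : 0 <= kappa a.
Proof. by rewrite invr_ge0 exprn_ge0. Qed.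

(** The terms 0 and 1 contribute 1 each, and the rest telescopes through 1/(x + 1)^2 <= 1/x - 1/(x +
    1). *)
Lemma sum_kappa L : \sum_(a < L) kappa a <= 3.
Proof.
have H k : \sum_(a < k.+2) kappa a <= 3 - k.+1%:R^-1.
  elim: k => [|k IH].
    by rewrite !big_ord_recr big_ord0/= /kappa /maxn/= !expr1n invr1; lra.
  rewrite big_ord_recr/=; apply: le_trans (lerD IH (lexx _)) _.
  rewrite /kappa /maxn/= -[k.+2%:R]natr1.
  set x : R := k.+1%:R; have x0 : 0 < x by rewrite ltr0n.
  have e : (x + 1)^-1 + ((x + 1) ^+ 2)^-1 <= x^-1.
    rewrite -subr_ge0 (_ : _ - _ = (x * (x + 1) ^+ 2)^-1).
      by rewrite invr_ge0 mulr_ge0 ?exprn_ge0 ?addr_ge0 ?ltW.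
    by field; rewrite !gt_eqF// addr_gt0.
  move: e; move: (x + 1)^-1 ((x + 1) ^+ 2)^-1 x^-1 => u v w; lra.
case: L => [|[|L]]; first by rewrite big_ord0.
  by rewrite big_ord_recr big_ord0/= /kappa /maxn/= expr1n invr1; lra.
by apply: le_trans (H L) _; rewrite gerBl invr_ge0.
Qed.

Variables (I : finType) (m p q : I -> R) (J : nat) (be : R).
Hypothesis m0 : forall i, 0 <= m i.
Hypothesis m1 : \sum_i m i <= 1.
Hypothesis p1 : forall i, `|p i| <= 1.
Hypothesis q1 : forall i, `|q i| <= 1.
Hypothesis cell : forall u v : R,
  \sum_(i | (`|p i - u| <= 2 ^- J) && (`|q i - v| <= 2 ^- J)) m i <= be.

Let N : R := 2 ^+ J.
Let N0 : 0 < N. Proof. exact: exprn_gt0. Qed.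

Let lvl (x : R) : nat := Num.trunc (N * `|x|).

Let lvlP x : (lvl x)%:R <= N * `|x| < (lvl x).+1%:R.
Proof. by apply: truncn_itv; apply: mulr_ge0 => //; exact: ltW. Qed.

(** Level 0 uses the maximum (2N)^2 of the kernel; the other levels use the decay 16 / x^2 together
    with N |x| >= lvl x. *)
Let lvl_fejer x : `|x| <= 2 -> fejer (2 ^ J.+1) x <= 16 * N ^+ 2 * kappa (lvl x).
Proof.
move=> x2; have /andP[h1 h2] := lvlP x; rewrite /kappa.
case: (lvl x) h1 h2 => [|l] h1 h2.
  rewrite /maxn/= expr1n invr1 mulr1; apply: le_trans (fejer_le _ _) _.
  rewrite natrX [2 ^+ J.+1]exprS exprMn -/N; have : 0 <= N ^+ 2 by exact: sqr_ge0.
  lra.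
have l0 : 0 < l.+1%:R :> R by rewrite ltr0n.
have x0 : x != 0.
  by apply: contraTneq h1 => ->; rewrite normr0 mulr0 -ltNge.
have F0 := fejer_ge0 (2 ^ J.+1) x; have Ff := fejer_far (2 ^ J.+1) x0 x2.
rewrite (maxn_idPr _ : maxn 1 l.+1 = l.+1)// ler_pdivlMr ?exprn_gt0//.
have : l.+1%:R ^+ 2 <= N ^+ 2 * x ^+ 2.
  rewrite -[x ^+ 2]real_normK ?num_real// -exprMn.
  by rewrite ler_sqr ?nnegrE// mulr_ge0// ltW.
move=> h; apply: le_trans (ler_wpM2l F0 h) _.
by rewrite mulrCA [leRHS]mulrC ler_wpM2l ?sqr_ge0.
Qed.

Let lvl_cell x a : lvl x = a ->
  (`|x - a%:R / N| <= 2 ^- J) || (`|x - (- (a%:R / N))| <= 2 ^- J).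
Proof.
move=> e; have /andP[] := lvlP x; rewrite e -natr1 -/N -[2 ^- J]/(N^-1) => h1 h2.
have h3 : a%:R / N <= `|x| by rewrite ler_pdivrMr// mulrC.
have h4 : `|x| <= a%:R / N + N^-1.
  by rewrite -[X in _ + X]mul1r -mulrDl ler_pdivlMr// mulrC ltW.
have [x0|x0] := leP 0 x.
  by apply/orP; left; rewrite ler_norml; rewrite ger0_norm// in h3 h4; have := invr_gt0 N; lra.
by apply/orP; right; rewrite ler_norml; rewrite ltr0_norm// in h3 h4; lra.
Qed.

(** Fix j and sort the i by the levels (a, b) of the two coordinate differences. By the choice of
    signs each class lies in four squares of radius 2^-J, so its mass is at most 4 be, and the
    kernels there are at most 16^2 N^4 kappa(a) kappa(b). Summing the two profiles costs 3 * 3. *)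
Lemma sum_fejer_cells :
  \sum_i \sum_j m i * m j * (fejer (2 ^ J.+1) (p i - p j) * fejer (2 ^ J.+1) (q i - q j))
  <= 36 * 16 ^+ J.+2 * be.
Proof.
have be0 : 0 <= be by apply: le_trans (cell 0 0); apply: sumr_ge0 => i _; exact: m0.
have N16 : 16 ^+ J = N ^+ 4 by rewrite /N exprAC; congr (_ ^+ _); ring.
rewrite exchange_big/=.
suff H j : \sum_i m i * (fejer (2 ^ J.+1) (p i - p j) * fejer (2 ^ J.+1) (q i - q j))
    <= 36 * 16 ^+ J.+2 * be.
  apply: (@le_trans _ _ (\sum_j m j * (36 * 16 ^+ J.+2 * be))); last first.
    rewrite -mulr_suml -[leRHS]mul1r ler_wpM2r//.
    by apply: mulr_ge0 => //; apply: mulr_ge0 => //; exact: exprn_ge0.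
  apply: ler_sum => j _; apply: le_trans (ler_wpM2l (m0 j) (H j)).
  by rewrite mulr_sumr; apply: ler_sum => i _; rewrite [m i * m j]mulrC -mulrA.
(* Differences of coordinates are at most 2 in modulus, so levels run up to 2N = 2^(J+1)
   inclusive. *)
pose L := (2 ^ J.+1).+1.
have d2 (f : I -> R) (f1 : forall i, `|f i| <= 1) i : `|f i - f j| <= 2.
  by have := f1 i; have := f1 j; rewrite !ler_norml; lra.
have lvlL (f : I -> R) (f1 : forall i, `|f i| <= 1) i : (lvl (f i - f j) < L)%N.
  rewrite ltnS -(ler_nat R) natrX exprSr -/N; have /andP[h _] := lvlP (f i - f j).
  by apply: le_trans h _; rewrite ler_pM2l// d2.
have ksum l : (l < L)%N -> kappa l = \sum_(a < L) kappa a * (l == a)%:R.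
  move=> lL; rewrite (bigD1 (Ordinal lL))//= eqxx mulr1 big1 ?addr0// => a.
  by rewrite -val_eqE/= eq_sym => /negbTE ->; rewrite mulr0.
pose s a b := \sum_(i | (lvl (p i - p j) == a) && (lvl (q i - q j) == b)) m i.
apply: (@le_trans _ _ (\sum_(a < L) \sum_(b < L) 16 ^+ 2 * N ^+ 4 * (kappa a * kappa b) * s a b)).
  apply: (@le_trans _ _ (\sum_i \sum_(a < L) \sum_(b < L) 16 ^+ 2 * N ^+ 4 * (kappa a * kappa b) *
     (m i * ((lvl (p i - p j) == a) && (lvl (q i - q j) == b))%:R))).
    apply: ler_sum => i _.
    have e : \sum_(a < L) \sum_(b < L) 16 ^+ 2 * N ^+ 4 * (kappa a * kappa b) *
     (m i * ((lvl (p i - p j) == a) && (lvl (q i - q j) == b))%:R) =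
     m i * ((16 * N ^+ 2 * kappa (lvl (p i - p j))) * (16 * N ^+ 2 * kappa (lvl (q i - q j)))).
      rewrite (ksum _ (lvlL _ p1 i)) (ksum _ (lvlL _ q1 i)).
      rewrite !(mulr_sumr, mulr_suml); apply: eq_bigr => a _.
      rewrite !(mulr_sumr, mulr_suml); apply: eq_bigr => b _.
      by rewrite -mulnb natrM; ring.
    by rewrite e ler_wpM2l// ler_pM ?fejer_ge0// lvl_fejer// d2.
  rewrite exchange_big/=; apply: ler_sum => a _.
  rewrite exchange_big/=; apply: ler_sum => b _.
  rewrite -mulr_sumr /s; rewrite (big_mkcond (fun i => _ && _))/=.
  apply: ler_wpM2l; first by rewrite !mulr_ge0 ?kappa_ge0 ?exprn_ge0 ?ltW.
  apply: ler_sum => i _.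
  by case: (_ && _); rewrite ?mulr1 ?mulr0.
have sle a b : s a b <= 4 * be.
  pose S u v := \sum_(i | (`|p i - u| <= 2 ^- J) && (`|q i - v| <= 2 ^- J)) m i.
  pose A : R := a%:R / N; pose B : R := b%:R / N.
  have : s a b <= S (p j + A) (q j + B) + S (p j + A) (q j - B) + (S (p j - A) (q j + B) + S (p j - A) (q j - B)).
    rewrite /s /S [leLHS]big_mkcond ![X in _ <= X + _ + _]big_mkcond ![X in _ <= _ + X + _]big_mkcond.
    rewrite ![X in _ <= _ + _ + (X + _)]big_mkcond ![X in _ <= _ + _ + (_ + X)]big_mkcond -!big_split/=.
    apply: ler_sum => i _.
    have mi := m0 i.
    have E x y z : x - (y + z) = x - y - z :> R by ring.
    rewrite !E.
    case: ifP => [/andP[/eqP /lvl_cell/orP[] -> /eqP /lvl_cell/orP[] ->]|_] /=;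
      do ?case: ifP => _; lra.
  have := cell (p j + A) (q j + B); have := cell (p j - A) (q j + B).
  have := cell (p j + A) (q j - B); have := cell (p j - A) (q j - B).
  rewrite -!/(S _ _); lra.
apply: (@le_trans _ _ (\sum_(a < L) \sum_(b < L) 16 ^+ 2 * N ^+ 4 * (kappa a * kappa b) * (4 * be))).
  apply: ler_sum => a _; apply: ler_sum => b _.
  by apply: ler_wpM2l => //; rewrite !mulr_ge0 ?kappa_ge0 ?exprn_ge0 ?ltW.
have -> : \sum_(a < L) \sum_(b < L) 16 ^+ 2 * N ^+ 4 * (kappa a * kappa b) * (4 * be) =
   4 * 16 ^+ 2 * (N ^+ 4 * be) * ((\sum_(a < L) kappa a) * \sum_(b < L) kappa b).
  rewrite big_distrlr/= mulr_sumr; apply: eq_bigr => a _.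
  by rewrite mulr_sumr; apply: eq_bigr => b _; ring.
have k3 := sum_kappa L.
have k0 : 0 <= \sum_(a < L) kappa a by apply: sumr_ge0 => a _; exact: kappa_ge0.
have : (\sum_(a < L) kappa a) * (\sum_(b < L) kappa b) <= 3 * 3 by rewrite ler_pM.
set S := \sum_(a < L) kappa a in k3 k0 *.
have SS : S * S <= 3 * 3 by apply: ler_pM.
rewrite (_ : 36 * 16 ^+ J.+2 * be = 4 * 16 ^+ 2 * (N ^+ 4 * be) * (3 * 3)); last first.
  by rewrite !exprS N16; ring.
apply: ler_wpM2l => //; apply: mulr_ge0; first by rewrite mulr_ge0.
by apply: mulr_ge0 => //; apply: exprn_ge0; exact: ltW.
Qed.

End Cells.

(** * Frequency-by-frequency comparison of kernels, and polar coordinates *)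

Section Core.
Context {R : realType}.

(** The decay 2^(-J/2) of the Bessel function at scale 2^J, divided by the size 2^J * 2^J of the
    coefficients of a product of two kernels of order 2^(J+1). *)
Definition weight (J : nat) : R := (Num.sqrt 2 ^+ J)^-1 * (4 ^+ J)^-1.

Lemma weight_ge0 J : 0 <= weight J.
Proof. by rewrite mulr_ge0 ?invr_ge0 ?exprn_ge0// sqrtr_ge0. Qed.

(** The order 2^(J+1) is twice the largest frequency considered, so [M - a] is still at least
    2^J. *)
Lemma fejw_lower J a : (a <= 2 ^ J)%N -> 2 ^+ J <= fejw (2 ^ J.+1) a :> R.
Proof.
move=> aJ; rewrite /fejw; apply: (@le_trans _ _ (1 * (2 ^ J.+1 - a)%:R)).
  rewrite mul1r -natrX ler_nat expnS mul2n -addnn.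
  by rewrite -addnBA// leq_addr.
by rewrite ler_wpM2r//; case: ifP => _; rewrite ?ler1n.
Qed.

Let s2le : Num.sqrt 2 <= 3 / 2 :> R.
Proof. by rewrite -(@ler_pXn2r _ 2)// ?nnegrE ?sqrtr_ge0// sqr_sqrtr//; lra. Qed.

Let s2gt : 0 < Num.sqrt 2 :> R.
Proof. by rewrite sqrtr_gt0. Qed.

(** One scale J of the sum on the right already dominates; the other terms are nonnegative. Assuming
    only the square of [B] covers both signs of the second frequency. The factor 4 * 4^n bounds the
    two weights on the left. *)
Lemma freq_bound n (a b : nat) (B r : R) : 0 < r -> r <= 4 -> B ^+ 2 = b%:R ^+ 2 ->
  fejw (2 ^ n) a * fejw (2 ^ n) b * circint (fun x => cos (a%:R * r * cos x + B * r * sin x))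
  <= 4 * 75 * 4 ^+ n / Num.sqrt r *
     \sum_(J < n.+1) weight J * (fejw (2 ^ J.+1) a * fejw (2 ^ J.+1) b).
Proof.
move=> r0 r3 Bb; set ci := circint _.
set K := 4 * 75 * 4 ^+ n / Num.sqrt r.
have sr0 : 0 < Num.sqrt r by rewrite sqrtr_gt0.
have K0 : 0 <= K by rewrite /K divr_ge0 ?mulr_ge0 ?exprn_ge0// ltW.
have T0 (J : nat) : 0 <= weight J * (fejw (2 ^ J.+1) a * fejw (2 ^ J.+1) b).
  by apply: mulr_ge0; [exact: weight_ge0|apply: mulr_ge0; exact: fejw_ge0].
have T1 : 0 <= K * \sum_(J < n.+1) weight J * (fejw (2 ^ J.+1) a * fejw (2 ^ J.+1) b).
  by apply: mulr_ge0 => //; apply: sumr_ge0 => J _; exact: T0.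
have wzero c : (2 ^ n <= c)%N -> fejw (2 ^ n) c = 0 :> R.
  by rewrite /fejw -subn_eq0 => /eqP ->; rewrite mulr0n mulr0.
have [an|an] := leqP (2 ^ n) a.
  by rewrite (wzero a an) !mul0r.
have [bn|bn] := leqP (2 ^ n) b.
  by rewrite (wzero b bn) mulr0 mul0r.
pose c := maxn a b.
have cn : (c < 2 ^ n)%N by rewrite gtn_max an.
(* [J] is the dyadic scale of the frequency [(a, b)] *)
suff [J Jn [aJ bJ ciJ]] : exists2 J, (J <= n)%N &
    [/\ (a <= 2 ^ J)%N, (b <= 2 ^ J)%N & ci <= 75 / Num.sqrt r / Num.sqrt 2 ^+ J].
  apply: (@le_trans _ _ (K * (weight J * (fejw (2 ^ J.+1) a * fejw (2 ^ J.+1) b)))); last first.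
    rewrite ler_wpM2l// (bigD1 (Ordinal (Jn : (J < n.+1)%N)))//= lerDl.
    by apply: sumr_ge0 => i _; exact: T0.
  have q0 : 0 < Num.sqrt 2 ^+ J :> R by rewrite exprn_gt0.
  apply: (@le_trans _ _ (4 * 4 ^+ n * (75 / Num.sqrt r / Num.sqrt 2 ^+ J))).
    apply: (@le_trans _ _ (fejw (2 ^ n) a * fejw (2 ^ n) b * (75 / Num.sqrt r / Num.sqrt 2 ^+ J))).
      by apply: ler_wpM2l => //; apply: mulr_ge0; exact: fejw_ge0.
    apply: ler_wpM2r; first by apply: divr_ge0; [apply: divr_ge0 => //|]; exact: ltW.
    have -> : 4 * 4 ^+ n = (2 * (2 ^ n)%:R) * (2 * (2 ^ n)%:R) :> R.
      rewrite natrX mulrACA -exprMn; congr (_ * _); first by ring.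
      by congr (_ ^+ _); ring.
    by apply: ler_pM; rewrite ?fejw_ge0 ?fejw_le.
  apply: (@le_trans _ _ (K * (weight J * (2 ^+ J * 2 ^+ J)))).
    rewrite /K /weight -exprMn (_ : 2 * 2 = 4 :> R); last by ring.
    rewrite le_eqVlt; apply/orP; left; apply/eqP; field.
    by rewrite !gt_eqF// exprn_gt0.
  apply: ler_wpM2l => //; apply: ler_wpM2l; first exact: weight_ge0.
  by apply: ler_pM; rewrite ?exprn_ge0 ?fejw_lower.
(* At frequency zero there is no decay; the trivial bound 2 pi is used at J = 0, and [r <= 4] makes
   it at most 75 / sqrt r. *)
have [c0|c0] := posnP c.
  exists 0%N => //; move: (leq_maxl a b) (leq_maxr a b); rewrite -/c c0 !leqn0 => /eqP -> /eqP ->.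
  split => //; rewrite expr0 divr1.
  apply: (@le_trans _ _ (circint (cst 1))).
    apply: le_circint => x; last exact: cos_le1.
    - apply: (@continuous_comp _ _ _ (fun x => a%:R * r * cos x + B * r * sin x)); last exact: continuous_cos.
      apply: continuousD; (apply: continuousM; first exact: cst_continuous).
        exact: continuous_cos.
      exact: continuous_sin.
    - exact: cst_continuous.
  rewrite circint_cst mul1r ler_pdivlMr//.
  have sr2 : Num.sqrt r <= 2.
    rewrite -(@ler_pXn2r _ 2)// ?nnegrE ?sqrtr_ge0// sqr_sqrtr; last exact: ltW.
    lra.
  have := @pi_lt4 R; have := @pi_gt0 R; nra.
(* The least J with c < 2^J, so that 2^(J-1) <= c. The Bessel bound at 2^(J-1) loses one factor sqrt
   2 <= 3/2, which turns 50 into 75. *)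
exists (trunc_log 2 c).+1.
  by rewrite -(ltn_exp2l _ _ (isT : 1 < 2)%N); apply: leq_ltn_trans cn; exact: trunc_logP.
have cJ : (c < 2 ^ (trunc_log 2 c).+1)%N by exact: trunc_log_ltn.
split.
- by apply/ltnW/(leq_ltn_trans _ cJ); exact: leq_maxl.
- by apply/ltnW/(leq_ltn_trans _ cJ); exact: leq_maxr.
pose rho : R := Num.sqrt (a%:R ^+ 2 + b%:R ^+ 2).
have rhoE : rho ^+ 2 = a%:R ^+ 2 + b%:R ^+ 2 by rewrite sqr_sqrtr// addr_ge0 ?sqr_ge0.
have rhoc : c%:R <= rho.
  rewrite -(@ler_pXn2r _ 2)// ?nnegrE ?sqrtr_ge0// rhoE /c.
  by case: (leqP a b) => _; rewrite ?lerDl ?lerDr sqr_ge0.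
have rho0 : 0 < rho by apply: lt_le_trans rhoc; rewrite ltr0n.
have rE : (rho * r) ^+ 2 = (a%:R * r) ^+ 2 + (B * r) ^+ 2.
  by rewrite !exprMn rhoE Bb; ring.
apply: le_trans (circint_cos_le (mulr_gt0 rho0 r0) rE) _.
rewrite (sqrtrM _ (ltW rho0)) invfM mulrA [leRHS]mulrAC.
apply: ler_wpM2r; first by rewrite invr_ge0 ltW.
have q0 : 0 < Num.sqrt 2 ^+ (trunc_log 2 c) :> R by rewrite exprn_gt0.
have h : Num.sqrt 2 ^+ (trunc_log 2 c) <= Num.sqrt rho.
  have -> : Num.sqrt 2 ^+ (trunc_log 2 c) = Num.sqrt (2 ^+ (trunc_log 2 c)) :> R.
    elim: (trunc_log 2 c) => [|k IH]; first by rewrite !expr0 sqrtr1.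
    by rewrite !exprS sqrtrM// IH.
  rewrite ler_wsqrtr//; apply: le_trans rhoc.
  by rewrite -natrX ler_nat; exact: trunc_logP.
rewrite exprS invfM mulrA.
apply: (@le_trans _ _ (50 / (Num.sqrt 2 ^+ trunc_log 2 c))).
  by apply: ler_wpM2l => //; rewrite lef_pV2// posrE// sqrtr_gt0.
apply: ler_wpM2r; first by rewrite invr_ge0 ltW.
by rewrite ler_pdivlMr//; have := s2le; lra.
Qed.

Lemma polar (x y : R) : exists2 psi : R, - pi <= psi <= pi &
  x = Num.sqrt (x ^+ 2 + y ^+ 2) * cos psi /\ y = Num.sqrt (x ^+ 2 + y ^+ 2) * sin psi.
Proof.
set rho := Num.sqrt _.
have rhoE : rho ^+ 2 = x ^+ 2 + y ^+ 2 by rewrite sqr_sqrtr// addr_ge0 ?sqr_ge0.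
have rho0 : 0 <= rho by exact: sqrtr_ge0.
have pi0 := @pi_gt0 R.
have [e|e] := eqVneq rho 0.
  have : x ^+ 2 + y ^+ 2 = 0 by rewrite -rhoE e expr0n.
  move=> /eqP; rewrite paddr_eq0 ?sqr_ge0// !sqrf_eq0 => /andP[/eqP -> /eqP ->].
  by exists 0; [lra|rewrite e !mul0r].
have rho1 : 0 < rho by rewrite lt_neqAle eq_sym e.
have xr : -1 <= x / rho <= 1.
  rewrite -ler_norml normrM normfV (gtr0_norm rho1) ler_pdivrMr// mul1r.
  by rewrite -(gtr0_norm rho1) -ler_sqr ?nnegrE// !real_normK ?num_real// rhoE lerDl sqr_ge0.
have ca : rho * cos (acos (x / rho)) = x by rewrite acosK ?in_itv//= mulrC divfK.
have sa : rho * sin (acos (x / rho)) = `|y|.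
  rewrite sin_acos// -{1}[rho]gtr0_norm// -sqrtr_sqr -sqrtrM ?sqr_ge0// -sqrtr_sqr.
  by congr Num.sqrt; rewrite mulrBr mulr1 -exprMn mulrCA divff// mulr1 rhoE; ring.
have a0 := acos_ge0 xr; have ap := acos_lepi xr.
have [y0|y0] := leP 0 y.
  by exists (acos (x / rho)); [lra|rewrite ca sa ger0_norm].
by exists (- acos (x / rho)); [lra|rewrite cosN sinN mulrN ca sa ltr0_norm// opprK].
Qed.

Lemma cos_lip (x y : R) : `|cos x - cos y| <= `|x - y|.
Proof.
wlog xy : x y / y <= x => [H|].
  have [/H//|/ltW/H] := leP y x.
  by rewrite distrC [leRHS]distrC.
have [|c _ ->] := @MVT_segment R (@cos R) (fun z => - sin z) y x xy.
  by apply: continuous_subspaceT => z; exact: continuous_cos.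
by rewrite normrM ler_piMl// normrN sin_max.
Qed.

Lemma sin_lip (x y : R) : `|sin x - sin y| <= `|x - y|.
Proof. by rewrite -!cosBpihalf; apply: le_trans (cos_lip _ _) _; rewrite opprB addrA addrNK. Qed.

End Core.

(** * Majorising the annulus by the averaged kernel *)

Section Annulus.
Context {R : realType}.

Lemma continuous_fejer M : continuous (@fejer R M).
Proof.
apply: (@continuous_sum _ _ _ (fun (a : 'I_M) x => fejw M a * cos (a%:R * x))) => a.
apply: continuous_mulf; first exact: continuous_cstf.
apply: (continuous_compf _ (@continuous_cos R)).
by apply: continuous_mulf; [exact: continuous_cstf|move=> x; exact: cvg_id].
Qed.

(** The losses in order: sqrt r <= 2; the two lower bounds M^2 / 4; the 8 in the arc length [h]; the
    factors of [freq_bound]; those of [sum_fejer_cells]. *)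
Definition annulus_const : R := 2 * 16 * 8 * (4 * 75) * (36 * 16 ^+ 2).

Lemma annulus_const_ge1 : 1 <= annulus_const.
Proof. by rewrite /annulus_const !mulr_ege1 ?exprn_ege1 ?ler1n. Qed.

Variables (I : finType) (m p q : I -> R) (n : nat) (r : R) (be : nat -> R).
Hypothesis m0 : forall i, 0 <= m i.
Hypothesis m1 : \sum_i m i <= 1.
Hypothesis p1 : forall i, `|p i| <= 1.
Hypothesis q1 : forall i, `|q i| <= 1.
Hypothesis cell : forall J, (J <= n)%N -> forall u v : R,
  \sum_(i | (`|p i - u| <= 2 ^- J) && (`|q i - v| <= 2 ^- J)) m i <= be J.
Hypothesis r_ge : 2 ^- n / 8 <= r.
Hypothesis r_le : r <= 4.

Let e0 : 0 < 2 ^- n :> R. Proof. by rewrite invr_gt0 exprn_gt0. Qed.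
Let r0 : 0 < r. Proof. by apply: lt_le_trans r_ge; rewrite divr_gt0. Qed.

Let good i j := `|Num.sqrt ((p i - p j) ^+ 2 + (q i - q j) ^+ 2) - r| <= 2 ^- n / 2.
(** An arc of this angle on the circle of radius r has length 2^-n / 8; [r_ge] gives h <= 1. *)
Let h : R := 2 ^- n / (8 * r).
Let M : nat := (2 ^ n)%N.
Let Phi i j (x : R) : R :=
  fejer M (p i - p j - r * cos x) * fejer M (q i - q j - r * sin x).

Let cPhi i j : continuous (Phi i j).
Proof.
apply: continuous_mulf; apply: (continuous_compf _ (continuous_fejer (M := M)));
  (apply: continuous_subf; first exact: continuous_cstf);
  (apply: continuous_mulf; first exact: continuous_cstf).
- exact: continuous_cos.
- exact: continuous_sin.
Qed.

Let Phi_ge0 i j x : 0 <= Phi i j x.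
Proof. by rewrite mulr_ge0 ?fejer_ge0. Qed.

(** For angles within [h] of the polar angle of the difference, the point of the circle is off by
    2^-n / 2 radially and 2^-n / 8 along the arc. Each coordinate is thus within 2^-n = 1 / M, and
    [fejer_near] applies to both factors. *)
Let lower i j : good i j -> (16 ^+ n / 16) * h <= circint (Phi i j).
Proof.
rewrite /good; have [psi psipi [E1 E2]] := polar (p i - p j) (q i - q j).
move: E1 E2; set rho := Num.sqrt _ => E1 E2 g.
have h0 : 0 <= h by rewrite divr_ge0 ?ltW// mulr_gt0.
have h1 : h <= 1.
  rewrite ler_pdivrMr ?mulr_gt0// mul1r; move: r_ge; rewrite ler_pdivrMr//; lra.
have rh : r * h = 2 ^- n / 8 by rewrite /h; field; rewrite ?gt_eqF ?exprn_gt0.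
(* The arc starts or ends at [psi], whichever keeps it inside [-pi, pi]. *)
pose a := if psi <= 0 then psi else psi - h.
have pi2 := @pi_ge2 R.
have aP : - pi <= a /\ a + h <= pi by rewrite /a; case/andP: psipi => ? ?; case: (leP psi 0) => ?; split; lra.
have [a1 a2] := aP.
apply: (@circint_arc _ (Phi i j) _ a) => // x xa.
have xpsi : `|psi - x| <= h by move: xa; rewrite /a ler_norml; case: (leP psi 0) => ? /andP[? ?]; lra.
have near (f : R -> R) (d : R) : d = rho * f psi -> `|f psi| <= 1 ->
    `|f psi - f x| <= `|psi - x| -> `|M%:R * (d - r * f x)| <= 1.
  move=> -> f1 fl; rewrite normrM ger0_norm// /M natrX.
  rewrite mulrC -ler_pdivlMr ?exprn_gt0// mul1r.
  have -> : rho * f psi - r * f x = (rho - r) * f psi + r * (f psi - f x) by ring.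
  apply: le_trans (ler_normD _ _) _; rewrite !normrM (gtr0_norm r0).
  have A1 : `|rho - r| * `|f psi| <= 2 ^- n / 2 * 1 by apply: ler_pM.
  have A2 : r * `|f psi - f x| <= r * h.
    by apply: ler_wpM2l; [exact: ltW|exact: le_trans xpsi].
  by have := e0; lra.
have -> : 16 ^+ n / 16 = (M%:R ^+ 2 / 4) * (M%:R ^+ 2 / 4) :> R.
  rewrite /M natrX (_ : 16 = 2 ^+ 4 :> R); last by ring.
  by rewrite [(2 ^+ 4) ^+ n]exprAC; move: (2 ^+ n) => X; field.
rewrite /Phi; apply: ler_pM; try by rewrite divr_ge0.
- by apply: fejer_near; apply: near => //; [exact: cos_max|exact: cos_lip].
- by apply: fejer_near; apply: near => //; [exact: sin_max|exact: sin_lip].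
Qed.

Let S : R := circint (fun x => \sum_i \sum_j m i * m j * Phi i j x).

Let cmPhi i j : continuous (fun x => m i * m j * Phi i j x).
Proof. by apply: continuous_mulf; [exact: continuous_cstf|exact: cPhi]. Qed.

Let S_lower : (\sum_i \sum_(j | good i j) m i * m j) * (16 ^+ n / 16 * h) <= S.
Proof.
rewrite /S circint_sum; last by move=> i; exact: continuous_sum.
rewrite mulr_suml; apply: ler_sum => i _.
rewrite circint_sum; last by move=> j; exact: cmPhi.
rewrite mulr_suml big_mkcond; apply: ler_sum => j _.
rewrite circintZ; last exact: cPhi.
case: ifPn => [/lower|_]; first by apply: ler_wpM2l; exact: mulr_ge0.
by rewrite !mulr_ge0//; apply: Rintegral_ge0.
Qed.

Let L : nat := (2 ^ n.+1)%N.
Let ep a b := energy m (fun i => a%:R * p i + b%:R * q i).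
Let em a b := energy m (fun i => a%:R * p i - b%:R * q i).
Let cosr (a b : nat) (B x : R) : R := cos (a%:R * r * cos x + B * r * sin x).

Let ccosr a b B : continuous (cosr a b B).
Proof.
apply: (continuous_compf _ (@continuous_cos R)); apply: continuous_addf;
  (apply: continuous_mulf; first exact: continuous_cstf).
  exact: continuous_cos.
exact: continuous_sin.
Qed.

Let K : R := 4 * 75 * 4 ^+ n / Num.sqrt r.

Let K0 : 0 <= K.
Proof. by rewrite divr_ge0 ?sqrtr_ge0// mulr_ge0 ?exprn_ge0. Qed.

(** Both sides are expanded over the same frequencies. As the energies are nonnegative, [freq_bound]
    may be applied to each coefficient, once for (a, b) and once for (a, -b). *)
Let S_upper : S <= K * \sum_(J < n.+1) weight J *
  \sum_i \sum_j m i * m j * (fejer (2 ^ J.+1) (p i - p j) * fejer (2 ^ J.+1) (q i - q j)).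
Proof.
have ML : (M <= L)%N by rewrite leq_exp2l.
have -> : S = circint (fun x => \sum_(a < L) \sum_(b < L) fejw M a * fejw M b / 2 *
   (ep a b * cosr a b b%:R x + em a b * cosr a b (- b%:R) x)).
  congr circint; apply/funext => x; rewrite (sum_fejer _ _ _ _ _ ML).
  apply: eq_bigr => a _; apply: eq_bigr => b _.
  by rewrite /cosr mulNr mulNr !mulrA.
have cP a b B e : continuous (fun x => e * cosr a b B x).
  by apply: continuous_mulf; [exact: continuous_cstf|exact: ccosr].
have cQ a b : continuous (fun x => ep a b * cosr a b b%:R x + em a b * cosr a b (- b%:R) x).
  by apply: continuous_addf; exact: cP.
have cT a b : continuous (fun x => fejw M a * fejw M b / 2 *
   (ep a b * cosr a b b%:R x + em a b * cosr a b (- b%:R) x)).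
  by apply: continuous_mulf; [exact: continuous_cstf|exact: cQ].
have -> : \sum_(J < n.+1) weight J *
    \sum_i \sum_j m i * m j * (fejer (2 ^ J.+1) (p i - p j) * fejer (2 ^ J.+1) (q i - q j)) =
  \sum_(a < L) \sum_(b < L) (ep a b + em a b) / 2 *
     \sum_(J < n.+1) weight J * (fejw (2 ^ J.+1) a * fejw (2 ^ J.+1) b).
  under [RHS]eq_bigr do under eq_bigr do rewrite mulr_sumr.
  under [RHS]eq_bigr do rewrite exchange_big/=.
  rewrite [RHS]exchange_big/=; apply: eq_bigr => J _.
  have JL : (2 ^ J.+1 <= L)%N by rewrite leq_exp2l// ltnS -ltnS.
  (* The kernels on the right have shift u = v = 0, so all their cosines equal 1. *)
  under eq_bigr do under eq_bigr do rewrite -[p _ - p _]subr0 -[q _ - q _]subr0.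
  rewrite (sum_fejer _ _ _ _ _ JL) mulr_sumr; apply: eq_bigr => a _.
  rewrite mulr_sumr; apply: eq_bigr => b _.
  by rewrite !mulr0 addr0 subr0 cos0 /ep /em; field.
rewrite circint_sum; last by move=> a; apply: continuous_sum => b; exact: cT.
rewrite mulr_sumr; apply: ler_sum => a _.
rewrite circint_sum; last by move=> b; exact: cT.
rewrite mulr_sumr; apply: ler_sum => b _.
rewrite circintZ; last exact: cQ.
rewrite circintD; [|exact: cP..].
rewrite circintZ; last exact: ccosr.
rewrite circintZ; last exact: ccosr.
have F1 := @freq_bound R n a b b%:R r r0 r_le erefl.
have F2 := @freq_bound R n a b (- b%:R) r r0 r_le (sqrrN _).
rewrite -/M -/K in F1 F2.
have ep0 : 0 <= ep a b / 2 by rewrite divr_ge0 ?energy_ge0.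
have em0 : 0 <= em a b / 2 by rewrite divr_ge0 ?energy_ge0.
have := lerD (ler_wpM2l ep0 F1) (ler_wpM2l em0 F2).
rewrite -/(cosr a b b%:R) -/(cosr a b (- b%:R)) => G.
by apply: le_trans (le_trans _ G) _; rewrite le_eqVlt; apply/orP; left; apply/eqP; field.
Qed.

(** [S_lower] and [S_upper] enclose the same average. Bounding each dyadic kernel by
    [sum_fejer_cells] turns [weight J] times 16^J into 4^J / 2^(J/2), and dividing by the lower
    factor leaves 2^-n sqrt r. *)
Lemma annulus_bound :
  \sum_i \sum_(j | `|Num.sqrt ((p i - p j) ^+ 2 + (q i - q j) ^+ 2) - r| <= 2 ^- n / 2) m i * m j
  <= annulus_const *
     (2 ^- n * \sum_(J < n.+1) 4 ^+ J / Num.sqrt 2 ^+ J * be J).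
Proof.
set P := \sum_i _; set T := \sum_(J < _) _.
have T0 : 0 <= T.
  apply: sumr_ge0 => J _; apply: mulr_ge0.
    by rewrite divr_ge0 ?exprn_ge0// sqrtr_ge0.
  have Jn : (J <= n)%N by rewrite -ltnS.
  by apply: le_trans (cell Jn 0 0); apply: sumr_ge0 => i _; exact: m0.
have H : P * (16 ^+ n / 16 * h) <= K * (36 * 16 ^+ 2 * T).
  apply: le_trans S_lower _; apply: le_trans S_upper _; apply: ler_wpM2l => //.
  rewrite /T mulr_sumr; apply: ler_sum => J _.
  have Jn : (J <= n)%N by rewrite -ltnS.
  have := sum_fejer_cells m0 m1 p1 q1 (cell Jn).
  move=> /(ler_wpM2l (weight_ge0 J))/le_trans; apply.
  rewrite /weight le_eqVlt; apply/orP; left; apply/eqP.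
  rewrite !exprS (_ : 16 ^+ J = 4 ^+ J * 4 ^+ J); last by rewrite -exprMn; congr (_ ^+ _); ring.
  by field; rewrite !expf_neq0// gt_eqF// sqrtr_gt0.
have sr0 : 0 < Num.sqrt r by rewrite sqrtr_gt0.
have sr2 : Num.sqrt r <= 2.
  rewrite -(@ler_pXn2r _ 2)// ?nnegrE ?sqrtr_ge0// sqr_sqrtr//; last exact: ltW.
  by have := r_le; lra.
have srr : Num.sqrt r * Num.sqrt r = r by rewrite -expr2 sqr_sqrtr// ltW.
have E : 16 ^+ n = 2 ^+ n * 2 ^+ n * (4 ^+ n) :> R.
  by rewrite -!exprMn; congr (_ ^+ _); ring.
have pos : 0 < 16 ^+ n / 16 * h.
  apply: mulr_gt0; first by apply: divr_gt0 => //; exact: exprn_gt0.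
  by apply: divr_gt0 => //; exact: mulr_gt0.
move: H; rewrite -ler_pdivlMr// => /le_trans; apply.
have -> : K * (36 * 16 ^+ 2 * T) / (16 ^+ n / 16 * h) =
   Num.sqrt r * (16 * 8 * (4 * 75) * (36 * 16 ^+ 2) * (2 ^- n * T)).
  rewrite /K /h E -[X in _ / (8 * X)]srr.
  by field; rewrite !gt_eqF ?exprn_gt0.
have -> : annulus_const * (2 ^- n * T) =
   2 * (16 * 8 * (4 * 75) * (36 * 16 ^+ 2) * (2 ^- n * T)) by rewrite /annulus_const; ring.
apply: ler_wpM2r => //.
by rewrite !mulr_ge0 ?exprn_ge0// ltW.
Qed.

End Annulus.

(** * Discretisation of the random variables *)

Section FiniteAdditivity.
Context {R : realType} {d} {T : measurableType d} (P : probability T R).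

Lemma fine_probability_bigcup (I : finType) (C : pred I) (F : I -> set T) :
  (forall i, measurable (F i)) -> trivIset setT F ->
  fine (P (\bigcup_(i in [set` C]) F i)) = \sum_(i | C i) fine (P (F i)).
Proof.
move=> mF tF; rewrite measure_fin_bigcup//; last exact: sub_trivIset tF.
rewrite -(bigfs _ (index_enum_uniq I)); last by move=> i _; rewrite mem_index_enum.
by rewrite sum_fine// => i _; exact: fin_num_measure.
Qed.

Lemma fine_probability_le (A B : set T) : measurable A -> measurable B ->
  A `<=` B -> fine (P A) <= fine (P B).
Proof.
move=> mA mB AB; apply: fine_le; [exact: fin_num_measure..|].
by apply: le_measure; rewrite ?inE.
Qed.

Lemma fine_probability_le1 (A : set T) : measurable A -> fine (P A) <= 1.
Proof.
move=> mA; rewrite -lee_fin fineK; last exact: fin_num_measure.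
exact: probability_le1.
Qed.

End FiniteAdditivity.

(** After squaring, the cross terms are controlled because each coordinate is at most the Euclidean
    norm. *)
Lemma sqrt_sumsq_lip {R : realType} (x y u v : R) :
  `|Num.sqrt (x ^+ 2 + y ^+ 2) - Num.sqrt (u ^+ 2 + v ^+ 2)| <= `|x - u| + `|y - v|.
Proof.
have H (a b a' b' : R) : Num.sqrt (a ^+ 2 + b ^+ 2) <= Num.sqrt (a' ^+ 2 + b' ^+ 2) + (`|a - a'| + `|b - b'|).
  set s := Num.sqrt (a' ^+ 2 + _).
  have s0 : 0 <= s by exact: sqrtr_ge0.
  have sE : s ^+ 2 = a' ^+ 2 + b' ^+ 2 by rewrite sqr_sqrtr// addr_ge0 ?sqr_ge0.
  have ha : `|a'| <= s.
    by rewrite -(ger0_norm s0) -ler_sqr ?nnegrE// !real_normK ?num_real// sE lerDl sqr_ge0.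
  have hb : `|b'| <= s.
    by rewrite -(ger0_norm s0) -ler_sqr ?nnegrE// !real_normK ?num_real// sE lerDr sqr_ge0.
  have t0 : 0 <= s + (`|a - a'| + `|b - b'|) by rewrite !addr_ge0.
  rewrite -[leRHS]ger0_norm// -sqrtr_sqr ler_wsqrtr//.
  have ea : a ^+ 2 <= (`|a'| + `|a - a'|) ^+ 2.
    rewrite -real_normK ?num_real// ler_sqr ?nnegrE ?addr_ge0//.
    by rewrite {1}(_ : a = a' + (a - a')) ?ler_normD//; ring.
  have eb : b ^+ 2 <= (`|b'| + `|b - b'|) ^+ 2.
    rewrite -real_normK ?num_real// ler_sqr ?nnegrE ?addr_ge0//.
    by rewrite {1}(_ : b = b' + (b - b')) ?ler_normD//; ring.
  apply: le_trans (lerD ea eb) _.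
  have na : `|a'| ^+ 2 = a' ^+ 2 by rewrite real_normK ?num_real.
  have nb : `|b'| ^+ 2 = b' ^+ 2 by rewrite real_normK ?num_real.
  have := normr_ge0 (a - a'); have := normr_ge0 (b - b').
  move: ha hb na nb sE; move: `|a'| `|b'| `|a - a'| `|b - b'| => A B U V ha hb na nb sE V0 U0.
  have h1 : A * U <= s * U by exact: ler_wpM2r.
  have h2 : B * V <= s * V by exact: ler_wpM2r.
  have h3 : 0 <= U * V by exact: mulr_ge0.
  have -> : (A + U) ^+ 2 + (B + V) ^+ 2 = s ^+ 2 + U ^+ 2 + V ^+ 2 + 2 * (A * U) + 2 * (B * V).
    by rewrite sE -na -nb; ring.
  have -> : (s + (U + V)) ^+ 2 = s ^+ 2 + U ^+ 2 + V ^+ 2 + 2 * (s * U) + 2 * (s * V) + 2 * (U * V) by ring.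
  lra.
have := H x y u v; have := H u v x y; rewrite ![`|u - x|]distrC ![`|v - y|]distrC => h1 h2.
rewrite ler_norml; lra.
Qed.

Section DistMeasurable.
Context {R : realType} {d} {T : measurableType d}.

Lemma measurable_dist2 (V V' : T -> R * R) : measurable_fun setT V ->
  measurable_fun setT V' -> measurable_fun setT (fun w => dist2 (V w) (V' w)).
Proof.
move=> mV mV'.
apply: (@measurableT_comp _ _ _ _ _ _ (@Num.sqrt R)).
  by apply: continuous_measurable_fun; exact: sqrt_continuous.
have m1 : measurable_fun setT (fun w => (V w).1) by exact: (measurableT_comp measurable_fst).
have m2 : measurable_fun setT (fun w => (V w).2) by exact: (measurableT_comp measurable_snd).
have m3 : measurable_fun setT (fun w => (V' w).1) by exact: (measurableT_comp measurable_fst).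
have m4 : measurable_fun setT (fun w => (V' w).2) by exact: (measurableT_comp measurable_snd).
apply: measurable_funD; apply: measurable_funX; exact: measurable_funB.
Qed.

Lemma measurable_ball2 (c : R * R) (r : R) (V : T -> R * R) :
  measurable_fun setT V -> measurable (V @^-1` ball2 c r).
Proof.
move=> mV; have md := measurable_dist2 (measurable_cst c) mV.
have -> : V @^-1` ball2 c r =
    setT `&` (fun w => dist2 (cst c w) (V w)) @^-1` `]-oo, r[.
  by apply/seteqP; split => w /=; rewrite in_itv/= /ball2/=; tauto.
by apply: md => //; exact: measurable_itv.
Qed.

End DistMeasurable.

Section Discretization.
Context {R : realType} {d} {T : measurableType d} (P : probability T R).
Variables (W W' : T -> R * R) (sigma C Rad : R).
Hypothesis mW : measurable_fun setT W.
Hypothesis mW' : measurable_fun setT W'.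
Hypothesis C0 : 0 < C.
Hypothesis Rad0 : 0 < Rad.
Hypothesis WF : frostman P W sigma C.
Hypothesis WR : forall w, ball2 ((0 : R), (0 : R)) Rad (W w).
Hypothesis indep : independent_copy P W W'.

Variables (N : nat) (a delta : R).
Hypothesis a0 : 0 <= a.
Hypothesis deltaN : 8 * delta <= 2 ^- N * Rad.

(** Cells have side 2^-N Rad / 16, so that rounding to a corner costs only a fraction of the annulus
    width. [p] and [q] are corner coordinates rescaled to [-1, 1]. *)
Let mesh : nat := (16 * 2 ^ N)%N.
Let H : R := mesh%:R.
Let L : nat := (mesh + mesh)%N.
Let I : finType := ('I_L.+1 * 'I_L.+1)%type.
Let cellI (k : nat) : set R := `[Rad * (k%:R / H - 1), Rad * (k.+1%:R / H - 1)[%classic.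
Let cell (i : I) : set (R * R) := cellI i.1 `*` cellI i.2.
Let p (i : I) : R := (i.1 : nat)%:R / H - 1.
Let q (i : I) : R := (i.2 : nat)%:R / H - 1.
Let m (i : I) : R := fine (P (W @^-1` cell i)).

Let H0 : 0 < H. Proof. by rewrite ltr0n muln_gt0 expn_gt0. Qed.
Let HE : H = 16 * 2 ^+ N. Proof. by rewrite /H natrM natrX. Qed.

Let mcell i : measurable (cell i).
Proof. by apply: measurableX; exact: measurable_itv. Qed.

Let mWcell i : measurable (W @^-1` cell i).
Proof. by rewrite -[_ @^-1` _]setTI; exact: mW. Qed.

Let mW'cell i : measurable (W' @^-1` cell i).
Proof. by rewrite -[_ @^-1` _]setTI; exact: mW'. Qed.

Let cellIP k (x : R) : cellI k x <-> k%:R <= (x / Rad + 1) * H < k.+1%:R.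
Proof.
rewrite /cellI/= in_itv/= [Rad * _]mulrC [Rad * (k.+1%:R / H - 1)]mulrC.
by rewrite -ler_pdivlMr// -ltr_pdivrMr// lerBlDr ltrBrDr ler_pdivrMr// ltr_pdivlMr.
Qed.

Let trivcellI k l x : cellI k x -> cellI l x -> k = l.
Proof.
move=> /cellIP /andP[h1 h2] /cellIP /andP[h3 h4].
have := le_lt_trans h1 h4; have := le_lt_trans h3 h2.
by rewrite !ltr_nat !ltnS => ? ?; apply/eqP; rewrite eqn_leq; apply/andP.
Qed.

Let trivcell i j x : cell i x -> cell j x -> i = j.
Proof.
case: i j => i1 i2 [j1 j2] [/= h1 h2] [/= h3 h4].
by congr pair; apply/val_inj; [exact: trivcellI h1 h3|exact: trivcellI h2 h4].
Qed.

Let coverI x : -Rad < x < Rad -> exists k : 'I_L.+1, cellI k x.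
Proof.
move=> xR; have b : -1 < x / Rad < 1.
  by rewrite ltr_pdivlMr// ltr_pdivrMr// mulN1r mul1r.
have y0 : 0 <= (x / Rad + 1) * H by apply: mulr_ge0; [lra|exact: ltW].
have /andP[h1 h2] := truncn_itv y0.
have kL : (Num.trunc ((x / Rad + 1) * H) < L.+1)%N.
  rewrite ltnS -(ler_nat R); apply: le_trans h1 _.
  rewrite /L natrD -/H; have := H0; nra.
by exists (Ordinal kL); apply/cellIP; rewrite /= h1.
Qed.

Let ball_coord (x : R * R) : ball2 (0, 0) Rad x -> -Rad < x.1 < Rad /\ -Rad < x.2 < Rad.
Proof.
rewrite /ball2/= /dist2/= !sub0r !sqrrN => h.
have k (y z : R) : Num.sqrt (y ^+ 2 + z ^+ 2) < Rad -> - Rad < y < Rad.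
  rewrite -ltr_norml; apply: le_lt_trans.
  by rewrite -sqrtr_sqr ler_wsqrtr// lerDl sqr_ge0.
by split; [exact: k h|apply: (k _ x.1); rewrite addrC].
Qed.

Let cover x : ball2 (0, 0) Rad x -> exists i : I, cell i x.
Proof.
move=> /ball_coord[/coverI[k1 h1] /coverI[k2 h2]].
by exists (k1, k2); split.
Qed.

Let indepm i j : fine (P (W @^-1` cell i `&` W' @^-1` cell j)) = m i * m j.
Proof.
have [h1 h2] := indep; rewrite h2// h1// fineM//; exact: fin_num_measure.
Qed.

(* [W'] lands in the ball only almost surely: its law is that of [W]. *)
Let W'cover : P (W' @^-1` (\bigcup_(i in setT) cell i)) = 1%E.
Proof.
have mc : measurable (\bigcup_(i in [set: I]) cell i).
  exact: fin_bigcup_measurable.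
have [h1 _] := indep; rewrite h1// (_ : _ @^-1` _ = setT) ?probability_setT//.
by apply/seteqP; split => // w _; have [i hi] := cover (WR w); exists i.
Qed.

Let triv (V : T -> R * R) : trivIset setT (fun i => V @^-1` cell i).
Proof. by apply/trivIsetP => i j _ _ ij; apply/seteqP; split => // w [h1 h2]; case/eqP: ij; exact: trivcell h1 h2. Qed.

Let m0 i : 0 <= m i. Proof. exact: fine_ge0. Qed.

Let sum_m (Q : pred I) : \sum_(i | Q i) m i = fine (P (\bigcup_(i in [set` Q]) (W @^-1` cell i))).
Proof. by rewrite fine_probability_bigcup. Qed.

Let m1 : \sum_i m i <= 1.
Proof.
rewrite (sum_m xpredT) fine_probability_le1//.
exact: fin_bigcup_measurable.
Qed.

Let coord1 (k : 'I_L.+1) : `|(k : nat)%:R / H - 1| <= 1.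
Proof.
have : (k : nat)%:R <= 2 * H.
  have := ltn_ord k; rewrite ltnS -(ler_nat R) /L natrD -/H; lra.
rewrite -ler_pdivrMr// => h; rewrite ler_norml.
have : 0 <= (k : nat)%:R / H by rewrite divr_ge0// ltW.
lra.
Qed.

Let Hle J : (J <= N)%N -> H^-1 <= 2 ^- J / 16.
Proof.
move=> JN; rewrite HE invfM mulrC ler_pM2r// lef_pV2 ?posrE ?exprn_gt0//.
by rewrite ler_weXn2l// ler1n.
Qed.

Let cellI_close k x : cellI k x -> 0 <= x / Rad - (k%:R / H - 1) < H^-1.
Proof.
move=> /cellIP; rewrite -natr1 => /andP[h1 h2]; apply/andP; split.
  by rewrite subr_ge0 lerBlDr ler_pdivrMr.
rewrite -(ltr_pM2r H0) mulVf ?gt_eqF//.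
have -> : (x / Rad - (k%:R / H - 1)) * H = (x / Rad + 1) * H - k%:R by field; rewrite !gt_eqF.
by rewrite ltrBlDl.
Qed.

Let be J : R := C * (3 * 2 ^- J * Rad) `^ sigma.

(** Points of the selected cells are within (1 + 1/16) 2^-J Rad of the centre in each coordinate,
    hence inside the ball of radius 3 * 2^-J Rad, where the Frostman condition applies. *)
Let cell_mass J : (J <= N)%N -> forall u v : R,
  \sum_(i | (`|p i - u| <= 2 ^- J) && (`|q i - v| <= 2 ^- J)) m i <= be J.
Proof.
move=> JN u v; have J0 : 0 < 2 ^- J :> R by rewrite invr_gt0 exprn_gt0.
have rad0 : 0 < 3 * 2 ^- J * Rad by rewrite !mulr_gt0.
have := WF (Rad * u, Rad * v) rad0.
have mB : measurable (W @^-1` ball2 (Rad * u, Rad * v) (3 * 2 ^- J * Rad)).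
  exact: measurable_ball2.
rewrite -[X in (X <= _)%E]fineK; last exact: fin_num_measure.
rewrite lee_fin => /(le_trans _); apply; rewrite sum_m.
apply: fine_probability_le => //; first exact: fin_bigcup_measurable.
move=> w [i /= /andP[iu iv] [/cellI_close c1 /cellI_close c2]].
rewrite /ball2/= /dist2/=.
have hJ := Hle JN.
have S (x y k : R) : `|k - y| <= 2 ^- J -> 0 <= x / Rad - k < H^-1 ->
    `|Rad * y - x| <= Rad * (5 / 4 * 2 ^- J).
  move=> h1 h2; have -> : Rad * y - x = Rad * (y - x / Rad) by field; rewrite gt_eqF.
  rewrite normrM gtr0_norm// ler_pM2l//; move: h1; rewrite !ler_norml.
  case/andP: h2; move: hJ J0; move: (x / Rad) H^-1 (2 ^- J) => X h e ? ? ? ? /andP[? ?]; lra.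
have s1 := S _ _ _ iu c1; have s2 := S _ _ _ iv c2.
have := sqrt_sumsq_lip (Rad * u - (W w).1) (Rad * v - (W w).2) 0 0.
rewrite expr0n/= addr0 sqrtr0 !subr0 => /(le_trans (ler_norm _)) h.
apply: le_lt_trans h _; apply: le_lt_trans (lerD s1 s2) _.
rewrite -mulrDr mulrC ltr_pM2r//; lra.
Qed.

Let bound : R := annulus_const *
     (2 ^- N * \sum_(J < N.+1) 4 ^+ J / Num.sqrt 2 ^+ J * be J).

(** The shift by 2^-N / 8 supplies the lower bound [r_ge] even when a = 0, while the rescaled
    interval stays within 2^-N / 8 of [r]. *)
Let r : R := a / Rad + 2 ^- N / 8.

(** For r > 4 the sum is empty: points of [-1, 1]^2 are at distance at most 3. *)
Let pairs_mass :
  \sum_i \sum_(j | `|Num.sqrt ((p i - p j) ^+ 2 + (q i - q j) ^+ 2) - r| <= 2 ^- N / 2) m i * m j <= bound.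
Proof.
have N0 : 0 < 2 ^- N :> R by rewrite invr_gt0 exprn_gt0.
have N1 : 2 ^- N <= 1 :> R by rewrite invf_le1 ?exprn_gt0// exprn_ege1// ler1n.
have ar : 0 <= a / Rad by rewrite divr_ge0// ltW.
have [r4|r4] := leP r 4.
  apply: annulus_bound => //; first by move=> i; exact: coord1.
    by move=> i; exact: coord1.
  by rewrite /r; lra.
have b0 : 0 <= bound.
  apply: mulr_ge0; first exact: le_trans annulus_const_ge1.
  apply: mulr_ge0; first exact: ltW.
  apply: sumr_ge0 => J _; apply: mulr_ge0; first by rewrite divr_ge0 ?exprn_ge0// sqrtr_ge0.
  by apply: mulr_ge0; [exact: ltW|exact: powR_ge0].
apply: le_trans b0; rewrite le_eqVlt; apply/orP; left; apply/eqP.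
apply: big1 => i _; apply: big_pred0 => j; apply/negbTE; rewrite -ltNge.
have c1 := coord1 i.1; have c2 := coord1 i.2.
have c3 := coord1 j.1; have c4 := coord1 j.2.
have hs : Num.sqrt ((p i - p j) ^+ 2 + (q i - q j) ^+ 2) <= 3.
  rewrite -(@ler_pXn2r _ 2)// ?nnegrE ?sqrtr_ge0// sqr_sqrtr; last by rewrite addr_ge0 ?sqr_ge0.
  rewrite -/(p i) in c1; rewrite -/(q i) in c2; rewrite -/(p j) in c3; rewrite -/(q j) in c4.
  have h (x y : R) : `|x| <= 1 -> `|y| <= 1 -> (x - y) ^+ 2 <= 4.
    by rewrite !ler_norml => /andP[? ?] /andP[? ?]; nra.
  have := h _ _ c1 c3; have := h _ _ c2 c4; lra.
rewrite ltr0_norm; lra.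
Qed.

(** Up to a null set the event lies in the disjoint union of the products of cells whose corners
    form a good pair; by independence that union has the mass bounded in [pairs_mass]. *)
Lemma dist_interval_prob (E : set T) : measurable E ->
  (forall w, E w -> a <= dist2 (W w) (W' w) < a + delta) ->
  fine (P E) <= bound.
Proof.
move=> mE hE; apply: le_trans pairs_mass.
pose G := W' @^-1` (\bigcup_(i in setT) cell i).
have mG : measurable G.
  rewrite /G preimage_bigcup; exact: fin_bigcup_measurable.
have PG : P E = P (E `&` G).
  have m1' : measurable (E `\` G) by exact: measurableD.
  have P0 : P (E `\` G) = 0%E.
    apply/eqP; rewrite -measure_le0.
    apply: (@le_trans _ _ (P (~` G))).
      apply: le_measure; rewrite ?inE//; exact: measurableC.
    by rewrite probability_setC// W'cover subee.
  apply: (etrans (measureDI P mE mG)); rewrite -[RHS]add0e.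
  by congr (_ + _)%E; exact: P0.
rewrite PG pair_big_dep/=.
pose good (ij : I * I) := `|Num.sqrt ((p ij.1 - p ij.2) ^+ 2 + (q ij.1 - q ij.2) ^+ 2) - r| <= 2 ^- N / 2.
pose F (ij : I * I) := W @^-1` cell ij.1 `&` W' @^-1` cell ij.2.
have mF ij : measurable (F ij) by exact: measurableI.
have tF : trivIset setT F.
  apply/trivIsetP => -[i1 i2] [j1 j2] _ _ ij; apply/seteqP; split => // w [/= [h1 h2] [h3 h4]].
  by move/eqP: ij; apply; congr pair; [exact: trivcell h1 h3|exact: trivcell h2 h4].
have -> : \sum_(ij | good ij) m ij.1 * m ij.2 = fine (P (\bigcup_(ij in [set` good]) F ij)).
  by rewrite fine_probability_bigcup//; apply: eq_bigr => ij _; rewrite -indepm.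
apply: fine_probability_le; [exact: measurableI|exact: fin_bigcup_measurable|].
move=> w [/hE /andP[h1 h2] [j _ hj]].
have [i hi] := cover (WR w).
exists (i, j); last by split.
have N0 : 0 < 2 ^- N :> R by rewrite invr_gt0 exprn_gt0.
change (is_true (good (i, j))); rewrite /good /=.
case: hi => /cellI_close i1 /cellI_close i2; case: hj => /cellI_close j1 /cellI_close j2.
rewrite -/(p i) in i1; rewrite -/(q i) in i2; rewrite -/(p j) in j1; rewrite -/(q j) in j2.
have hN := Hle (leqnn N).
(* Error budget in units of 2^-N: 1/8 between [D] and [r], plus 1/16 per coordinate from rounding,
   which stays below the allowed 1/2. *)
pose D := Num.sqrt (((W w).1 / Rad - (W' w).1 / Rad) ^+ 2 + ((W w).2 / Rad - (W' w).2 / Rad) ^+ 2).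
have DE : D * Rad = dist2 (W w) (W' w).
  rewrite -[X in _ * X](gtr0_norm Rad0) -sqrtr_sqr -sqrtrM ?addr_ge0 ?sqr_ge0//.
  by congr Num.sqrt; field; rewrite gt_eqF.
have D1 : a / Rad <= D by rewrite ler_pdivrMr// DE.
have D2 : D < a / Rad + 2 ^- N / 8.
  rewrite -(ltr_pM2r Rad0) DE mulrDl divfK ?gt_eqF//; apply: lt_le_trans h2 _.
  by rewrite lerD2l mulrAC ler_pdivlMr// mulrC; exact: deltaN.
have S := sqrt_sumsq_lip (p i - p j) (q i - q j) ((W w).1 / Rad - (W' w).1 / Rad) ((W w).2 / Rad - (W' w).2 / Rad).
rewrite -/D in S.
have S1 : `|p i - p j - ((W w).1 / Rad - (W' w).1 / Rad)| <= 2 ^- N / 16.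
  by case/andP: i1 => ? ?; case/andP: j1 => ? ?; rewrite ler_norml; lra.
have S2 : `|q i - q j - ((W w).2 / Rad - (W' w).2 / Rad)| <= 2 ^- N / 16.
  by case/andP: i2 => ? ?; case/andP: j2 => ? ?; rewrite ler_norml; lra.
move: S; rewrite ler_norml => /andP[S3 S4]; rewrite ler_norml /r; lra.
Qed.

End Discretization.

(** * Summation over scales and entropy *)

Section Scales.
Context {R : realType}.
Implicit Types (sigma t : R).

Lemma sum_geometric_le (x : R) n : 0 <= x < 1 -> \sum_(J < n) x ^+ J <= (1 - x)^-1.
Proof.
move=> /andP[x0 x1]; rewrite -[leRHS]mul1r ler_pdivlMr ?subr_gt0//.
have -> : (\sum_(J < n) x ^+ J) * (1 - x) = 1 - x ^+ n.
  elim: n => [|n IH]; first by rewrite big_ord0 expr0; ring.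
  by rewrite big_ord_recr/= mulrDl IH exprS; ring.
by rewrite gerBl exprn_ge0.
Qed.

(** From 2^e >= 1 + e ln 2. The factor 1 / e is the source of the term in |log(2s - t - 1/2)|. *)
Lemma inv_one_minus_powR2 (e : R) : 0 < e <= 1 ->
  (1 - 2 `^ (- e))^-1 <= (1 + (ln 2)^-1) / e.
Proof.
move=> /andP[e0 e1]; have l0 : 0 < ln 2 :> R by rewrite ln_gt0// ltr1n.
pose y := e * ln 2; have y0 : 0 < y by rewrite mulr_gt0.
have h : 1 + y <= 2 `^ e by rewrite /powR gt_eqF// expR_ge1Dx.
have h' : 2 `^ (- e) <= (1 + y)^-1.
  by rewrite powRN lef_pV2 ?posrE ?powR_gt0// addr_gt0.
have y1 : 0 < 1 + y by rewrite addr_gt0.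
have h2 : y / (1 + y) <= 1 - 2 `^ (- e).
  have -> : y / (1 + y) = 1 - (1 + y)^-1 by field; rewrite gt_eqF.
  by rewrite lerD2l lerN2.
apply: (@le_trans _ _ ((y / (1 + y))^-1)).
  by rewrite lef_pV2 ?posrE ?divr_gt0//; apply: lt_le_trans h2; rewrite divr_gt0.
have -> : (y / (1 + y))^-1 = (e + (ln 2)^-1) / e.
  by rewrite /y; field; rewrite !gt_eqF// -/y.
by rewrite ler_pM2r ?invr_gt0// lerD2r.
Qed.

(** The J-th term is 2^(J(3/2 - sigma)) = y^J x^J. Since t <= 1 gives y >= 1, y^J is replaced by
    y^N, which combines with 2^-N into 2^(-Nt); a convergent geometric series in x remains. *)
Lemma sum_scales sigma t N : t <= 1 -> 0 < sigma - t - 1 / 2 ->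
  2 ^- N * \sum_(J < N.+1) 4 ^+ J / Num.sqrt 2 ^+ J * (2 ^- J) `^ sigma
  <= (2 ^- N) `^ t * (1 - 2 `^ (- (sigma - t - 1 / 2)))^-1.
Proof.
set e := sigma - t - 1 / 2 => t1 e0.
pose x : R := 2 `^ (- e); pose y : R := 2 `^ (1 - t).
have x0 : 0 <= x by exact: powR_ge0.
have x1 : x < 1.
  rewrite /x powRN invf_lt1 ?powR_gt0// /powR gt_eqF//.
  by rewrite -[ltLHS]expR0 ltr_expR; apply: mulr_gt0 => //; apply: ln_gt0; rewrite ?ltr1n.
have y1 : 1 <= y by rewrite -(powRr0 2) ler_powR ?ler1n// subr_ge0.
have E J : 4 ^+ J / Num.sqrt 2 ^+ J * (2 ^- J) `^ sigma = y ^+ J * x ^+ J :> R.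
  have two : (2 : R) != 0 by [].
  have -> : y ^+ J * x ^+ J = (2 `^ (3 / 2 - sigma)) ^+ J.
    rewrite -exprMn /x /y -powRD ?two ?implybT//.
    by congr ((2 `^ _) ^+ _); rewrite /e; field.
  have pX (u : R) : (2 `^ u) ^+ J = 2 `^ (u * J%:R) by rewrite -powR_mulrn ?powR_ge0// -powRrM.
  have e1 : 4 ^+ J = 2 `^ (2 * J%:R) :> R.
    by rewrite -pX powR_mulrn//; congr (_ ^+ _); ring.
  have e2 : Num.sqrt 2 ^+ J = 2 `^ (2^-1 * J%:R) :> R by rewrite -pX powR12_sqrt.
  have e3 : (2 ^- J) `^ sigma = 2 `^ (- J%:R * sigma) by rewrite -powR_invn// -powRrM.
  rewrite pX e1 e2 e3 -powRB ?two ?implybT// -powRD ?two ?implybT//.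
  by congr (2 `^ _); field.
apply: (@le_trans _ _ (2 ^- N * \sum_(J < N.+1) y ^+ N * x ^+ J)).
  apply: ler_wpM2l; first by rewrite invr_ge0 exprn_ge0.
  apply: ler_sum => J _; rewrite E; apply: ler_wpM2r; first exact: exprn_ge0.
  by rewrite ler_weXn2l// -ltnS.
rewrite -mulr_sumr mulrA.
have -> : 2 ^- N * y ^+ N = (2 ^- N) `^ t.
  have two : (2 : R) != 0 by [].
  rewrite /y -powR_invn// -[(2 `^ (1 - t)) ^+ N]powR_mulrn ?powR_ge0// -!powRrM -powRD ?two ?implybT//.
  by congr (2 `^ _); ring.
apply: ler_wpM2l; first exact: powR_ge0.
by apply: sum_geometric_le; rewrite x0.
Qed.

Lemma dyadic_between (x : R) : 0 < x -> x <= 1 ->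
  exists N : nat, x <= 2 ^- N /\ 2 ^- N < 2 * x.
Proof.
move=> x0 x1; have ix1 : 1 <= x^-1 by rewrite invf_ge1.
pose k := Num.trunc x^-1.
have /andP[h1 h2] : k%:R <= x^-1 < k.+1%:R.
  by apply: truncn_itv; rewrite invr_ge0 ltW.
have k0 : (0 < k)%N by rewrite truncn_gt0.
exists (trunc_log 2 k); split.
  rewrite -[leLHS]invrK lef_pV2 ?posrE ?exprn_gt0 ?invr_gt0//.
  by apply: le_trans h1; rewrite -natrX ler_nat trunc_logP.
rewrite -[ltRHS]invrK ltf_pV2 ?posrE ?exprn_gt0 ?invr_gt0 ?mulr_gt0//.
rewrite invfM ltr_pdivrMl//; apply: lt_le_trans h2 _.
by rewrite -exprS -natrX ler_nat trunc_log_ltn.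
Qed.

End Scales.

(** * Entropy from a bound on the atoms *)

Section Entropy.
Context {R : realType} {d} {T : measurableType d} (P : probability T R).

(** Entropy averages -log p over the atoms, so a uniform lower bound b passes to the average. [V]
    and [G] reduce the sum to finitely many values carrying full mass. *)
Lemma entropy_ge (X : T -> R) (V : set R) (G : set T) (b : R) :
  (forall v, measurable (X @^-1` [set v])) ->
  finite_set V -> measurable G -> P G = 1%E -> (forall w, G w -> V (X w)) ->
  (forall v, 0 < fine (P (X @^-1` [set v])) ->
     b <= - log2 (fine (P (X @^-1` [set v])))) ->
  (b%:E <= entropy P X)%E.
Proof.
move=> mX fV mG PG GV Hb; rewrite /entropy.
pose V' := V `&` range X.
have fV' : finite_set V' by exact: finite_setIl.
apply: esum_ge; exists V'; first by split => // v [].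
have tV : trivIset V' (fun v => X @^-1` [set v]).
  exact: trivIset_preimage1.
have mU : measurable (\bigcup_(v in V') X @^-1` [set v]).
  exact: fin_bigcup_measurable.
have PU : P (\bigcup_(v in V') X @^-1` [set v]) = 1%E.
  apply/eqP; rewrite eq_le probability_le1//= -PG; apply: le_measure; rewrite ?inE//.
  by move=> w Gw; exists (X w) => //; split; [exact: GV|exists w].
apply: (@le_trans _ _ (\sum_(v \in V') (b%:E * P (X @^-1` [set v])))%E).
  have := PU; rewrite measure_fin_bigcup// => PU'.
  have -> : (\sum_(v \in V') (b%:E * P (X @^-1` [set v])) = b%:E * \sum_(v \in V') P (X @^-1` [set v]))%E.
    rewrite !fsbig_finite//= -ge0_sume_distrr//.
  by rewrite PU' mule1.
apply: lee_fsum => // v _.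
rewrite -[X in (_ * X <= _)%E]fineK; last exact: fin_num_measure.
rewrite -EFinM lee_fin; set q := fine _.
have q0 : 0 <= q by exact: fine_ge0.
case: ifPn => [/eqP ->|qn]; first by rewrite mulr0.
have qp : 0 < q by rewrite lt_neqAle eq_sym qn.
by rewrite mulrC -mulrN ler_pM2l// Hb.
Qed.

End Entropy.

(** * Mass of the level sets of the discretised distance *)

Section LevelSets.
Context {R : realType} {d} {T : measurableType d} (P : probability T R).

Lemma Dn_itv n (x : R) : Dn n x <= x < Dn n x + 2 ^- n.
Proof.
have h0 : 0 < 2 ^+ n :> R by rewrite exprn_gt0.
have /andP[h1 h2] := floor_itv (2 ^+ n * x).
rewrite /Dn ler_pdivrMr// [x * _]mulrC h1/=.
rewrite (_ : _ + _ = (Num.floor (2 ^+ n * x) + 1)%:~R / 2 ^+ n); last first.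
  by rewrite intrD mulrDl mul1r.
by rewrite ltr_pdivlMr// mulrC.
Qed.

Lemma measurable_Dn_level n (v : R) : measurable ((@Dn R n) @^-1` [set v]).
Proof.
have h0 : 0 < 2 ^+ n :> R by rewrite exprn_gt0.
have [[k vk]|nk] := pselect (exists k : int, v = k%:~R / 2 ^+ n); last first.
  rewrite (_ : _ @^-1` _ = set0); first exact: measurable0.
  apply/seteqP; split => // x /= xv; apply: nk.
  by exists (Num.floor (2 ^+ n * x)); rewrite -xv.
rewrite (_ : _ @^-1` _ = `[v, v + 2 ^- n[%classic); first exact: measurable_itv.
apply/seteqP; split => x /=; rewrite in_itv/=; first by move=> <-; exact: Dn_itv.
move=> /andP[h1 h2]; rewrite /Dn vk; congr (_%:~R / _); apply: floor_def.
move: h1 h2; rewrite vk ler_pdivrMr// [x * _]mulrC => -> /=.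
rewrite (_ : _ + _ = (k + 1)%:~R / 2 ^+ n); last by rewrite intrD mulrDl mul1r.
by rewrite ltr_pdivlMr// mulrC.
Qed.

(** Here 9 = 3^2 bounds 3^sigma from the radius 3 * 2^-J Rad, 16 comes from rounding to a dyadic
    scale, and the last factor from [inv_one_minus_powR2]. *)
Definition level_const : R := annulus_const * 9 * 16 * (1 + (ln 2)^-1).

Lemma ln2_gt0 : 0 < ln 2 :> R.
Proof. by rewrite ln_gt0// ltr1n. Qed.

Lemma level_const_ge : 8 <= level_const.
Proof.
have l0 : 1 <= 1 + (ln 2)^-1 :> R by rewrite lerDl invr_ge0 ltW ?ln2_gt0.
apply: (@le_trans _ _ (1 * 9 * 16 * 1)); first by lra.
apply: ler_pM => //; apply: ler_wpM2r => //; apply: ler_wpM2r => //.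
exact: annulus_const_ge1.
Qed.

Lemma level_const_gt0 : 0 < level_const.
Proof. by apply: lt_le_trans level_const_ge. Qed.

Variables (W W' : T -> R * R) (sigma C Rad t : R).
Hypothesis mW : measurable_fun setT W.
Hypothesis mW' : measurable_fun setT W'.
Hypothesis sigma2 : sigma <= 2.
Hypothesis t0 : 0 <= t.
Hypothesis t1 : t <= 1.
Hypothesis tsigma : 0 < sigma - t - 1 / 2 <= 1.
Hypothesis C0 : 0 < C.
Hypothesis Rad0 : 0 < Rad.
Hypothesis WF : frostman P W sigma C.
Hypothesis WR : forall w, ball2 ((0 : R), (0 : R)) Rad (W w).
Hypothesis indep : independent_copy P W W'.

Let e := sigma - t - 1 / 2.

(** The Frostman condition on the ball containing the whole range. *)
Let mass_ge1 : 1 <= C * Rad `^ sigma.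
Proof.
have := WF (0, 0) Rad0; rewrite (_ : W @^-1` _ = setT).
  by rewrite probability_setT lee_fin.
by apply/seteqP; split => // w _; exact: WR.
Qed.

Lemma level_set_prob n (v : R) :
  fine (P ((@Dn R n \o (fun w => dist2 (W w) (W' w))) @^-1` [set v]))
  <= level_const * (C * Rad `^ (sigma - t)) * (2 ^- n) `^ t / e.
Proof.
have [e0 e1] := andP tsigma.
have d0 : 0 < 2 ^- n :> R by rewrite invr_gt0 exprn_gt0.
set E := _ @^-1` _.
have mE : measurable E.
  rewrite /E comp_preimage -[_ @^-1` _]setTI.
  by apply: (measurable_dist2 mW mW') => //; exact: measurable_Dn_level.
have EP w : E w -> v <= dist2 (W w) (W' w) < v + 2 ^- n.
  by rewrite /E/= => <-; exact: Dn_itv.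
have rhs0 : 0 <= level_const * (C * Rad `^ (sigma - t)) * (2 ^- n) `^ t / e.
  apply: divr_ge0; last exact: ltW.
  apply: mulr_ge0; last exact: powR_ge0.
  apply: mulr_ge0; first exact: ltW level_const_gt0.
  by apply: mulr_ge0; [exact: ltW|exact: powR_ge0].
have [v0|v0] := leP 0 v; last first.
  rewrite (_ : E = set0) ?measure0//; apply/seteqP; split => // w /= h.
  move: h v0 => <-; rewrite ltNge => /negP; apply.
  rewrite divr_ge0 ?exprn_ge0// ler0z floor_ge0 mulr_ge0 ?exprn_ge0//.
  exact: sqrtr_ge0.
have RadE : C * Rad `^ sigma = C * Rad `^ (sigma - t) * Rad `^ t.
  by rewrite -mulrA -powRD ?subrK// (gt_eqF Rad0) implybT.
(* The smallest value of 2^-N compatible with [deltaN] for intervals of length 2^-n. *)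
pose del := 8 * (2 ^- n / Rad).
have del0 : 0 < del by rewrite mulr_gt0// divr_gt0.
have deltE (x : R) : 0 <= x -> (x * del) `^ t * Rad `^ t = (8 * x) `^ t * (2 ^- n) `^ t.
  move=> x0; have dge := ltW del0; have Rge := ltW Rad0; have nge := ltW d0.
  rewrite -powRM//; last exact: mulr_ge0.
  rewrite -powRM//; last exact: mulr_ge0.
  by congr (_ `^ t); rewrite /del; field; rewrite !gt_eqF// exprn_gt0.
have ie : 1 <= e^-1 by rewrite invf_ge1.
set X := C * Rad `^ (sigma - t); set Y := (2 ^- n) `^ t.
have X0 : 0 <= X by rewrite mulr_ge0 ?powR_ge0// ltW.
have XY0 : 0 <= X * Y by rewrite mulr_ge0 ?powR_ge0.
(* When del > 1 the resolution is too coarse for [Rad], but then [mass_ge1] already makes the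
   right-hand side at least 1. *)
have [del1|del1] := leP del 1; last first.
  apply: le_trans (fine_probability_le1 P mE) _.
  apply: (@le_trans _ _ (8 * (X * Y))).
    have h1 : 1 <= (1 * del) `^ t.
      by rewrite mul1r -(powRr0 del) ler_powR// ltW.
    apply: le_trans mass_ge1 _; rewrite RadE -/X.
    apply: (@le_trans _ _ (X * ((1 * del) `^ t * Rad `^ t))).
      by apply: ler_wpM2l => //; rewrite ler_peMl// powR_ge0.
    rewrite deltE// mulr1 mulrCA; apply: ler_wpM2r => //.
    by apply: ler1_powR => //; rewrite ler1n.
  rewrite -[_ * X * Y]mulrA -[leLHS]mulr1; apply: ler_pM => //; first exact: (mulr_ge0 (ler0n R 8) XY0).
  by apply: ler_wpM2r => //; exact: level_const_ge.
have [N [N1 N2]] := dyadic_between del0 del1.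
have dN : 8 * 2 ^- n <= 2 ^- N * Rad.
  by rewrite -ler_pdivrMr// -mulrA.
have s0 : 0 <= sigma by move: e0 t0; lra.
apply: le_trans (dist_interval_prob mW mW' C0 Rad0 WF WR indep v0 dN mE EP) _.
apply: (@le_trans _ _ (annulus_const * (9 * (C * Rad `^ sigma) *
    (2 ^- N * \sum_(J < N.+1) 4 ^+ J / Num.sqrt 2 ^+ J * (2 ^- J) `^ sigma)))).
  apply: ler_wpM2l; first exact: le_trans annulus_const_ge1.
  rewrite [leRHS]mulrCA; apply: ler_wpM2l; first by rewrite invr_ge0 exprn_ge0.
  rewrite [leRHS]mulr_sumr; apply: ler_sum => J _.
  rewrite [leRHS]mulrCA; apply: ler_wpM2l; first by rewrite divr_ge0 ?exprn_ge0// sqrtr_ge0.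
  have J0 : 0 <= 2 ^- J :> R by rewrite invr_ge0 exprn_ge0.
  rewrite powRM ?mulr_ge0// ?(ltW Rad0)// powRM//.
  rewrite (_ : C * _ = C * Rad `^ sigma * (2 ^- J) `^ sigma * 3 `^ sigma); last by ring.
  rewrite (_ : 9 * _ * _ = C * Rad `^ sigma * (2 ^- J) `^ sigma * 9); last by ring.
  apply: ler_wpM2l.
    apply: mulr_ge0; last exact: powR_ge0.
    by apply: mulr_ge0; [exact: ltW|exact: powR_ge0].
  have -> : 9 = 3 `^ 2%:R :> R by rewrite powR_mulrn//; ring.
  by apply: ler_powR => //; rewrite ler1n.
have S := sum_scales N t1 e0; rewrite -/e in S.
have I := inv_one_minus_powR2 tsigma; rewrite -/e in I.
(* 2^-N is less than 2 del, and the factors 2 and 8 give 16^t <= 16. *)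
have Y16 : (2 ^- N) `^ t * Rad `^ t <= 16 * Y.
  apply: (@le_trans _ _ ((2 * del) `^ t * Rad `^ t)).
    apply: ler_wpM2r; first exact: powR_ge0.
    apply: ge0_ler_powR => //; rewrite ?nnegrE.
    - by rewrite invr_ge0 exprn_ge0.
    - by apply: mulr_ge0 => //; exact: ltW.
    - exact: ltW.
  rewrite deltE//; apply: ler_wpM2r; first exact: powR_ge0.
  rewrite (_ : 8 * 2 = 16 :> R); last by ring.
  by apply: ler1_powR => //; rewrite ler1n.
have LHS : 2 ^- N * \sum_(J < N.+1) 4 ^+ J / Num.sqrt 2 ^+ J * (2 ^- J) `^ sigma
    <= (2 ^- N) `^ t * ((1 + (ln 2)^-1) / e).
  by apply: le_trans S _; apply: ler_wpM2l => //; exact: powR_ge0.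
have c0 : 0 <= annulus_const :> R by exact: le_trans annulus_const_ge1.
apply: (@le_trans _ _ (annulus_const * (9 * (C * Rad `^ sigma) * ((2 ^- N) `^ t * ((1 + (ln 2)^-1) / e))))).
  apply: ler_wpM2l => //; apply: ler_wpM2l => //.
  by apply: mulr_ge0 => //; apply: mulr_ge0; [exact: ltW|exact: powR_ge0].
rewrite RadE -/X /level_const.
set L2 := 1 + (ln 2)^-1.
have L20 : 0 <= L2 by rewrite addr_ge0// invr_ge0 ltW// ln2_gt0.
rewrite (_ : annulus_const * _ = annulus_const * 9 * L2 * X * e^-1 * ((2 ^- N) `^ t * Rad `^ t)); last by ring.
rewrite (_ : annulus_const * 9 * 16 * L2 * X * Y / e = annulus_const * 9 * L2 * X * e^-1 * (16 * Y)); last by ring.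
apply: ler_wpM2l => //.
have ie0 : 0 <= e^-1 by rewrite invr_ge0 ltW.
apply: mulr_ge0 => //; apply: mulr_ge0 => //; apply: mulr_ge0 => //.
exact: mulr_ge0.
Qed.

End LevelSets.

(** * Base-2 logarithms *)

Section Log.
Context {R : realType}.
Implicit Types x y : R.

Lemma le_log2 x y : 0 < x -> x <= y -> log2 x <= log2 y.
Proof.
move=> x0 xy; rewrite /log2 ler_pM2r ?invr_gt0 ?ln2_gt0//.
by rewrite ler_ln ?posrE//; exact: lt_le_trans xy.
Qed.

Lemma log2M x y : 0 < x -> 0 < y -> log2 (x * y) = log2 x + log2 y.
Proof. by move=> x0 y0; rewrite /log2 lnM ?posrE// mulrDl. Qed.

Lemma log2V x : 0 < x -> log2 x^-1 = - log2 x.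
Proof. by move=> x0; rewrite /log2 lnV ?posrE// mulNr. Qed.

Lemma log2_powR x y : log2 (x `^ y) = y * log2 x.
Proof. by rewrite /log2 ln_powR mulrA. Qed.

Lemma log2_pow2 n : log2 (2 ^+ n) = n%:R :> R.
Proof. by rewrite /log2 lnXn// -[ln 2 *+ n]mulr_natl mulfK// gt_eqF// ln2_gt0. Qed.

Lemma le_logp x : log2 x <= logp x.
Proof. by rewrite /logp le_max lexx. Qed.

Lemma logp_ge0 x : 0 <= logp x.
Proof. by rewrite /logp le_max lexx orbT. Qed.

End Log.

Theorem mainTheorem12 (R : realType) :
  exists K : R, forall t : R, t <= 1 ->
  exists Kt : R,
  forall (s C Rad : R), 1 / 2 < s < 1 -> 0 < C -> 0 < Rad ->
  s < t -> t < 2 * s - 1 / 2 ->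
  forall (d : measure_display) (T : measurableType d) (P : probability T R)
         (W W' : T -> R * R),
    measurable_fun setT W -> measurable_fun setT W' ->
    frostman P W (2 * s) C ->
    (forall w, ball2 ((0 : R), (0 : R)) Rad (W w)) ->
    independent_copy P W W' ->
    forall n : nat,
      ((n%:R * t - logp C - K * logp Rad
        - K * `|log2 (2 * s - t - 1 / 2)| - Kt)%:E
       <= Hn P n (fun w => dist2 (W w) (W' w)))%E.
Proof.
(* K = 2 covers the exponent 2s - t of [Rad] and the coefficient 1 of |log e|; the last constant is
   the logarithm of [level_const]. *)
exists 2 => t t1; exists (log2 level_const).
move=> s C Rad /andP[s0 s1] C0 Rad0 st ts d T P W W' mW mW' WF WR indep n.
have e01 : 0 < 2 * s - t - 1 / 2 <= 1 by apply/andP; split; lra.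
set e := 2 * s - t - 1 / 2 in e01 *.
have [e0 e1] := andP e01.
have mZ := measurable_dist2 mW mW'.
have sig2 : 2 * s <= 2 by lra.
have t0 : 0 <= t by lra.
(* When [W] and [W'] lie in the ball, each coordinate difference is at most 2 Rad, so the distance
   is at most 4 Rad and takes finitely many dyadic values. For [W'] this holds with probability
   one. *)
pose K := (Num.trunc (2 ^+ n * (4 * Rad))).+1.
pose V := [set (k%:R / 2 ^+ n : R) | k in `I_K].
apply: (@entropy_ge R d T P _ V (W' @^-1` ball2 (0, 0) Rad)).
- move=> v; rewrite comp_preimage -[_ @^-1` _]setTI.
  by apply: mZ => //; exact: measurable_Dn_level.
- exact/finite_image/finite_II.
- exact: measurable_ball2.
- have [h _] := indep; rewrite h.
    rewrite (_ : _ @^-1` _ = setT) ?probability_setT//.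
    by apply/seteqP; split => // w _; exact: WR.
  have := @measurable_ball2 R _ _ (0, 0) Rad id (@measurable_id _ _ setT).
  by [].
- move=> w Gw; rewrite /V /=.
  set z := dist2 (W w) (W' w).
  have z0 : 0 <= z by exact: sqrtr_ge0.
  have zR : z <= 4 * Rad.
    have bc (x : R * R) : ball2 (0, 0) Rad x -> `|x.1| <= Rad /\ `|x.2| <= Rad.
      rewrite /ball2/= /dist2/= !sub0r !sqrrN => /ltW hx; split; apply: le_trans hx;
        by rewrite -sqrtr_sqr ler_wsqrtr// ?lerDl ?lerDr sqr_ge0.
    have [a1 a2] := bc _ (WR w); have [b1 b2] := bc _ Gw.
    have := sqrt_sumsq_lip ((W w).1 - (W' w).1) ((W w).2 - (W' w).2) 0 0.
    rewrite expr0n/= addr0 sqrtr0 !subr0 => /(le_trans (ler_norm _))/le_trans; apply.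
    have := ler_normB (W w).1 (W' w).1; have := ler_normB (W w).2 (W' w).2.
    lra.
  have y0 : 0 <= 2 ^+ n * z by rewrite mulr_ge0 ?exprn_ge0.
  exists (Num.trunc (2 ^+ n * z)).
    rewrite /K /= ltnS; apply: le_truncn.
    by apply: ler_wpM2l => //; exact: exprn_ge0.
  rewrite /Dn /=; congr (_ / _); rewrite -/z truncn_floor y0.
  by rewrite natr_absz ger0_norm// floor_ge0.
move=> v p0.
set b := _ - log2 level_const.
have := level_set_prob mW mW' sig2 t0 t1 e01 C0 Rad0 WF WR indep n v.
move: p0; set p := fine _ => p0 hp.
rewrite lerNr; apply: le_trans (le_log2 p0 hp) _.
have L0 := @level_const_gt0 R.
have d0 : 0 < 2 ^- n :> R by rewrite invr_gt0 exprn_gt0.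
have R0 : 0 < Rad `^ (2 * s - t) by exact: powR_gt0.
have D0 : 0 < (2 ^- n) `^ t :> R by exact: powR_gt0.
have CR0 : 0 < C * Rad `^ (2 * s - t) by exact: mulr_gt0.
have LC0 : 0 < level_const * (C * Rad `^ (2 * s - t)) by exact: mulr_gt0.
rewrite log2M ?invr_gt0//; last exact: mulr_gt0.
rewrite log2V// log2M// log2M// log2M// !log2_powR log2V ?exprn_gt0// log2_pow2.
have h1 := le_logp C.
(* log Rad may be negative, so it is first replaced by its positive part; only then can 0 <= 2s - t
   <= 2 be used. *)
have h2 : (2 * s - t) * log2 Rad <= 2 * logp Rad.
  apply: (@le_trans _ _ ((2 * s - t) * logp Rad)).
    by apply: ler_wpM2l; [lra|exact: le_logp].
  by apply: ler_wpM2r; [exact: logp_ge0|lra].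
have h3 : - log2 e <= `|log2 e| by rewrite -normrN ler_norm.
have h4 : 0 <= `|log2 e| by exact: normr_ge0.
rewrite /b -/e; lra.
Qed.
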